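(* For $1<\alpha<2$, the norm of the Hilbert matrix operator $\mathcal{H}$ acting on $\mathcal{B}^\alpha$ satisfies $$\|\mathcal{H}\|_{\mathcal{B}^\alpha\rightarrow\mathcal{B}^\alpha}\leq\frac{2^{\alpha}\pi}{\sin(\alpha-1)\pi}+\frac{1}{2-\alpha}.$$
   Context: $\mathbb{D}$ is the open unit disk in $\mathbb{C}$ and $H(\mathbb{D})$ is the set of analytic functions on $\mathbb{D}$. For $0<\alpha<\infty$, the $\alpha$-Bloch space $\mathcal{B}^\alpha$ consists of those $f\in H(\mathbb{D})$ with $$\|f\|_{\mathcal{B}^\alpha}=|f(0)|+\sup_{z\in\mathbb{D}}(1-|z|^2)^{\alpha}|f'(z)|<\infty.$$ The Hilbert matrix operator $\mathcal{H}$ acts on $f(z)=\sum_{k\ge 0}a_kz^k\in H(\mathbb{D})$ by $$\mathcal{H}f(z)=\sum_{n=0}^\infty\left(\sum_{k=0}^\infty\frac{a_k}{n+k+1}\right)z^n,$$ whenever the right-hand side makes sense and defines an analytic function in $\mathbb{D}$. For normed spaces $X,Y$ of analytic functions, $\|\mathcal{H}\|_{X\to Y}=\sup\{\|\mathcal{H}f\|_Y:\ f\in X,\ \|f\|_X\le 1\}$. *)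

(* Defs.v *)
From Stdlib Require Import Reals.
From Coquelicot Require Import Coquelicot.

Open Scope R_scope.

(** Analytic functions on the open unit disk are represented by total functions
    [C -> C]; every notion below only depends on their values on the disk. *)

Definition unit_disk (z : C) : Prop := Cmod z < 1.

Definition analytic_at (f : C -> C) (z0 : C) : Prop :=
  exists (c : nat -> C) (r : R),
    0 < r /\
    forall z : C, Cmod (z - z0)%C < r ->
      is_pseries (K := C_AbsRing) (V := C_NormedModule) c (z - z0)%C (f z).

Definition analytic_on_disk (f : C -> C) : Prop :=
  forall z : C, unit_disk z -> analytic_at f z.

(** Coquelicot's total [C_derive] is the complex derivative only where the
    function is complex-differentiable (see [is_C_derive_unique]); hence the
    two quantities below are meaningful for functions analytic on the disk. *)

Definition bloch_seminorm (alpha : R) (f : C -> C) : Rbar :=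
  Lub_Rbar (fun y : R => exists z : C, unit_disk z /\
    y = Rpower (1 - Cmod z ^ 2) alpha * Cmod (C_derive f z)).

Definition bloch_norm (alpha : R) (f : C -> C) : Rbar :=
  Rbar_plus (Finite (Cmod (f (RtoC 0)))) (bloch_seminorm alpha f).

Definition bloch_space (alpha : R) (f : C -> C) : Prop :=
  analytic_on_disk f /\ Rbar_lt (bloch_norm alpha f) p_infty.

Definition power_series_on_disk (a : nat -> C) (f : C -> C) : Prop :=
  forall z : C, unit_disk z ->
    is_pseries (K := C_AbsRing) (V := C_NormedModule) a z (f z).

(** The Hilbert matrix operator is only partially defined, hence a relation:
    [is_hilbert f g] states that the series defining the image of [f] make
    sense and that this image is the analytic function [g] (which is therefore
    unique on the disk).  The inner series are not required to converge
    absolutely. *)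

Definition is_hilbert (f g : C -> C) : Prop :=
  exists a b : nat -> C,
    power_series_on_disk a f /\
    (forall n : nat,
      is_series (K := C_AbsRing) (V := C_NormedModule)
        (fun k : nat => (a k / RtoC (INR (n + k + 1)))%C) (b n)) /\
    power_series_on_disk b g /\
    analytic_on_disk g.

Definition operator_norm (T : (C -> C) -> (C -> C) -> Prop)
    (X : (C -> C) -> Prop) (normX normY : (C -> C) -> Rbar) : Rbar :=
  Rbar_lub (fun y : Rbar => exists f g : C -> C,
    X f /\ Rbar_le (normX f) (Finite 1) /\ T f g /\ y = normY g).

(* Main.v *)
(** If [f] has Taylor coefficients [a_k], then [b_n = sum_k a_k / (n + k + 1)]
    is the improper integral of [t^n f(t)] over [(0, 1)]. Integrating the Bloch
    bound gives [|f z| <= |f 0| + M ((1 - |z|)^(1-alpha) - 1) / (alpha - 1)],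
    hence [|b_n| <= |f 0| / (n+1) + M / (alpha-1) (beta_n - 1 / (n+1))] with
    [beta_n = B(n+1, c)], [c = 2 - alpha]. The case [n = 0] yields the summand
    [1 / (2 - alpha)]. For the derivative of the image, [(n+1) beta_(n+1)]
    divided by the [n]-th coefficient of [(1 - x)^(-alpha)] increases to
    [(1-c) pi / sin (pi c)]; this is the one-sided Euler product
    [sin (pi c) <= pi c prod_(k <= N) (1 - c^2 / k^2)], obtained from the
    recurrence for [int_0^(pi/2) cos (2 c x) (cos x)^(2N) dx].

    The series [b_n] converges only conditionally in general. It is handled by
    Abel summation from [|a_0 + ... + a_M| = O(M^(alpha-1+e))], an L^1 bound on
    the Dirichlet kernel (sampled at roots of unity) on the circle of radius
    [1 - 1 / (2(M+1))], where [f] is [O(M^(alpha-1))]; Abel's limit theorem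
    then identifies the sum with the integral. *)

Require Import Defs.
From Stdlib Require Import Reals Lra Lia.
From Coquelicot Require Import Coquelicot.

Open Scope R_scope.

(** The normalisation bounds |f 0| + M, with M the seminorm of f, so both parts must be tracked. The
    estimate reached for the image is 3 |f 0| + M T, where T is the constant of the theorem; it is
    at most T (|f 0| + M) because T >= 3. The factor 2^alpha comes from the weight: the bound on f'
    is weakened from 1 - |z|^2 to 1 - |z|, and the return to 1 - |z|^2 for the image costs (1 +
    |z|)^alpha <= 2^alpha. Analyticity is given by a local expansion at each point, whereas the
    operator acts on Taylor coefficients at 0 valid on the whole disk. This obstacle is the reason
    for Cauchy's formula, obtained by differentiating a circle mean along a homotopy. The integrals
    of f in the overview are realised as comparisons of increments: a complex number is rotated onto
    the real axis, an explicit real primitive is compared with it through derivatives, and a left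
    limit at 1 closes the argument. This is compatible with conditional convergence. *)

(** * Complex series, power series and complex derivatives *)

Lemma pow_n_Cpow (z : C) (n : nat) : pow_n (K := C_Ring) z n = (z ^ n)%C.
Proof. induction n as [|n IH]; simpl; [reflexivity | now rewrite IH]. Qed.

Lemma Cplus_minus (u v : C) : (u + (v - u))%C = v.
Proof. ring. Qed.

(** Unfolds the filters into increments. This form can be combined with real parameters in the chain
    rule along paths, and with the remainder estimates for power series. *)
Lemma is_derive_C_eps (f : C -> C) (z l : C) :
  is_derive (K := C_AbsRing) (V := C_NormedModule) f z l <->
  forall eps : R, 0 < eps -> exists delta : R, 0 < delta /\
    forall h : C, Cmod h < delta ->
      Cmod (f (z + h) - f z - h * l)%C <= eps * Cmod h.
Proof.
split.
- intros [_ H] eps He.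
  destruct (H z (fun P hP => hP) (mkposreal eps He)) as [d Hd].
  exists d. split. apply cond_pos.
  intros h Hh.
  specialize (Hd (z + h)%C).
  assert (Hb : ball (M := AbsRing_UniformSpace C_AbsRing) z d (z + h)%C).
  { change (Cmod ((z + h) - z)%C < d). replace (z + h - z)%C with h by ring. exact Hh. }
  specialize (Hd Hb).
  change (Cmod (f (z + h) - f z - ((z + h) - z) * l)%C <= eps * Cmod ((z + h) - z)%C) in Hd.
  replace (z + h - z)%C with h in Hd by ring. exact Hd.
- intros H. split.
  apply is_linear_scal_l.
  intros x Hx.
  assert (E : z = x).
  { apply (is_filter_lim_locally_unique (V := AbsRing_NormedModule C_AbsRing)). exact Hx. }
  subst x.
  intros eps. destruct (H eps (cond_pos eps)) as [d [Hd1 Hd]].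
  exists (mkposreal d Hd1). intros y Hy.
  change (Cmod (y - z)%C < d) in Hy.
  specialize (Hd (y - z)%C Hy).
  rewrite Cplus_minus in Hd.
  exact Hd.
Qed.

Lemma is_series_C_eps (a : nat -> C) (l : C) :
  is_series (K := C_AbsRing) (V := C_NormedModule) a l <->
  forall eps : R, 0 < eps -> exists N : nat, forall n : nat, (N <= n)%nat ->
    Cmod (sum_n (G := C_AbelianMonoid) a n - l)%C < eps.
Proof.
split.
- intros H eps He.
  apply (filterlim_locally_ball_norm (K := C_AbsRing) (U := C_NormedModule)) with (eps := mkposreal eps He) in H.
  exact H.
- intros H.
  apply (filterlim_locally_ball_norm (K := C_AbsRing) (U := C_NormedModule)).
  intros eps. apply (H eps), cond_pos.
Qed.

Notation C_series := (is_series (K := C_AbsRing) (V := C_NormedModule)).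
Notation C_pseries := (is_pseries (K := C_AbsRing) (V := C_NormedModule)).
Notation C_sum := (sum_n (G := C_AbelianMonoid)).
Notation C_is_derive := (is_derive (K := C_AbsRing) (V := C_NormedModule)).

Lemma C_sum_S (a : nat -> C) (n : nat) : C_sum a (S n) = (C_sum a n + a (S n))%C.
Proof. apply (sum_Sn (G := C_AbelianMonoid)). Qed.

Lemma C_sum_0 (a : nat -> C) : C_sum a 0 = a 0%nat.
Proof. apply (sum_O (G := C_AbelianMonoid)). Qed.

Lemma R_sum_S (a : nat -> R) (n : nat) : sum_n a (S n) = sum_n a n + a (S n).
Proof. apply (sum_Sn (G := R_AbelianMonoid)). Qed.

Lemma R_sum_0 (a : nat -> R) : sum_n a 0 = a 0%nat.
Proof. apply (sum_O (G := R_AbelianMonoid)). Qed.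

Lemma C_pseries_series (a : nat -> C) (z l : C) :
  C_pseries a z l <-> C_series (fun k => (z ^ k * a k)%C) l.
Proof.
unfold is_pseries; split; apply is_series_ext; intros n;
  rewrite <- pow_n_Cpow; reflexivity.
Qed.

Lemma re_C_sum (a : nat -> C) (n : nat) : Re (C_sum a n) = sum_n (fun k => Re (a k)) n.
Proof.
induction n as [|n IH].
- now rewrite C_sum_0, R_sum_0.
- now rewrite C_sum_S, R_sum_S, re_plus, IH.
Qed.

Lemma im_C_sum (a : nat -> C) (n : nat) : Im (C_sum a n) = sum_n (fun k => Im (a k)) n.
Proof.
induction n as [|n IH].
- now rewrite C_sum_0, R_sum_0.
- now rewrite C_sum_S, R_sum_S, im_plus, IH.
Qed.

Lemma im_le_Cmod (c : C) : Rabs (Im c) <= Cmod c.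
Proof.
eapply Rle_trans; [|apply Rmax_Cmod]. apply Rmax_r.
Qed.

Lemma Cmod_le_re_im (c : C) : Cmod c <= Rabs (Re c) + Rabs (Im c).
Proof.
destruct c as [x y]; simpl.
replace (x, y) with (RtoC x + Ci * RtoC y)%C.
eapply Rle_trans; [apply Cmod_triangle|].
rewrite Cmod_mult, !Cmod_R.
replace (Cmod Ci) with 1. simpl; lra.
unfold Cmod, Ci; simpl. replace (0 * (0 * 1) + 1 * (1 * 1)) with 1 by ring. now rewrite sqrt_1.
apply injective_projections; simpl; ring.
Qed.

Lemma R_series_eps (a : nat -> R) (l : R) :
  is_series a l <->
  forall eps : R, 0 < eps -> exists N : nat, forall n : nat, (N <= n)%nat ->
    Rabs (sum_n a n - l) < eps.
Proof.
split.
- intros H eps He.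
  apply (filterlim_locally_ball_norm (K := R_AbsRing) (U := R_NormedModule)) with (eps := mkposreal eps He) in H.
  exact H.
- intros H.
  apply (filterlim_locally_ball_norm (K := R_AbsRing) (U := R_NormedModule)).
  intros eps. apply (H eps), cond_pos.
Qed.

Lemma C_series_re_im (a : nat -> C) (l : C) :
  C_series a l <->
  is_series (fun k => Re (a k)) (Re l) /\ is_series (fun k => Im (a k)) (Im l).
Proof.
rewrite is_series_C_eps, !R_series_eps. split.
- intros H; split; intros eps He; destruct (H eps He) as [N HN]; exists N; intros n Hn;
    specialize (HN n Hn); eapply Rle_lt_trans; try exact HN.
  + rewrite <- re_C_sum. unfold Rminus. rewrite <- re_opp, <- re_plus. apply re_le_Cmod.
  + rewrite <- im_C_sum. unfold Rminus. rewrite <- im_opp, <- im_plus. apply im_le_Cmod.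
- intros [H1 H2] eps He.
  destruct (H1 (eps / 2)) as [N1 HN1]. lra.
  destruct (H2 (eps / 2)) as [N2 HN2]. lra.
  exists (max N1 N2). intros n Hn.
  specialize (HN1 n ltac:(lia)). specialize (HN2 n ltac:(lia)).
  rewrite <- re_C_sum in HN1. rewrite <- im_C_sum in HN2.
  eapply Rle_lt_trans. apply Cmod_le_re_im.
  unfold Cminus. rewrite re_plus, im_plus, re_opp, im_opp. unfold Rminus in *. lra.
Qed.

Lemma C_series_unique (a : nat -> C) (l l' : C) : C_series a l -> C_series a l' -> l = l'.
Proof.
rewrite !C_series_re_im. intros [H1 H2] [H3 H4].
apply injective_projections.
- apply is_series_unique in H1. apply is_series_unique in H3. simpl in *. unfold Re in *. congruence.
- apply is_series_unique in H2. apply is_series_unique in H4. simpl in *. unfold Im in *. congruence.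
Qed.

Lemma Cmod_C_sum_le (a : nat -> C) (b : nat -> R) (n : nat) :
  (forall k, (k <= n)%nat -> Cmod (a k) <= b k) -> Cmod (C_sum a n) <= sum_n b n.
Proof.
induction n as [|n IH]; intros H.
- rewrite C_sum_0, R_sum_0. now apply H.
- rewrite C_sum_S, R_sum_S. eapply Rle_trans. apply Cmod_triangle.
  apply Rplus_le_compat. apply IH. intros; apply H; lia. apply H; lia.
Qed.

Lemma Cmod_series_le_bound (a : nat -> C) (l : C) (B : R) :
  C_series a l -> (forall n, Cmod (C_sum a n) <= B) -> Cmod l <= B.
Proof.
intros H HB. apply le_epsilon. intros eps He.
destruct (proj1 (is_series_C_eps a l) H eps He) as [N HN].
specialize (HN N (le_n N)). specialize (HB N).
replace l with (C_sum a N + - (C_sum a N - l))%C by ring.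
eapply Rle_trans. apply Cmod_triangle. rewrite Cmod_opp. lra.
Qed.

Lemma sum_n_le_series (b : nat -> R) (B : R) (n : nat) :
  (forall k, 0 <= b k) -> is_series b B -> sum_n b n <= B.
Proof.
intros Hb HB.
apply Rnot_lt_le; intros Hlt.
destruct (proj1 (R_series_eps b B) HB (sum_n b n - B)) as [N HN]. lra.
specialize (HN (N + n)%nat ltac:(lia)).
assert (sum_n b n <= sum_n b (N + n)).
{ clear -Hb. induction N as [|N IH]. simpl; lra. simpl. rewrite R_sum_S. specialize (Hb (S (N + n))). lra. }
rewrite Rabs_pos_eq in HN; lra.
Qed.

Lemma Cmod_series_le (a : nat -> C) (l : C) (b : nat -> R) (B : R) :
  C_series a l -> is_series b B -> (forall n, Cmod (a n) <= b n) -> Cmod l <= B.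
Proof.
intros Ha Hb H. eapply Cmod_series_le_bound. exact Ha.
intros n. eapply Rle_trans. apply Cmod_C_sum_le. intros; apply H.
apply sum_n_le_series; auto. intros k; eapply Rle_trans; [apply Cmod_ge_0|apply H].
Qed.

Lemma ex_C_series_le (a : nat -> C) (b : nat -> R) :
  ex_series b -> (forall n, Cmod (a n) <= b n) -> exists l : C, C_series a l.
Proof.
intros Hb H.
destruct (ex_series_le (K := C_AbsRing) (V := C_CompleteNormedModule) a b H Hb) as [l Hl].
now exists l.
Qed.

Lemma C_series_minus (a b : nat -> C) (la lb : C) :
  C_series a la -> C_series b lb -> C_series (fun n => (a n - b n)%C) (la - lb)%C.
Proof. apply (is_series_minus (K := C_AbsRing) (V := C_NormedModule)). Qed.

Lemma C_series_scal (c : C) (a : nat -> C) (l : C) :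
  C_series a l -> C_series (fun n => (c * a n)%C) (c * l)%C.
Proof. apply (is_series_scal (K := C_AbsRing) (V := C_NormedModule)). Qed.

Lemma C_series_decr (a : nat -> C) (l : C) :
  C_series (fun n => a (S n)) l -> C_series a (l + a 0%nat)%C.
Proof.
intros H. apply (is_series_decr_1 (K := C_AbsRing) (V := C_NormedModule)).
change (C_series (fun n => a (S n)) ((l + a 0%nat) + - a 0%nat)%C).
replace (l + a 0%nat + - a 0%nat)%C with l by ring. exact H.
Qed.

Lemma C_series_lim_0 (a : nat -> C) (l : C) :
  C_series a l -> forall eps, 0 < eps -> exists N, forall n, (N <= n)%nat -> Cmod (a n) < eps.
Proof.
intros H eps He.
destruct (proj1 (is_series_C_eps a l) H (eps / 2)) as [N HN]. lra.
exists (S N). intros [|n] Hn. lia.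
replace (a (S n)) with ((C_sum a (S n) - l) - (C_sum a n - l))%C by (rewrite C_sum_S; ring).
eapply Rle_lt_trans. apply Cmod_triangle. rewrite Cmod_opp.
generalize (HN n ltac:(lia)) (HN (S n) ltac:(lia)). lra.
Qed.

Lemma eventually_bounded (u : nat -> R) (B : R) (N : nat) :
  (forall n, (N <= n)%nat -> u n <= B) -> exists B', 0 < B' /\ forall n, u n <= B'.
Proof.
intros H.
assert (HN : exists B1, forall n, (n <= N)%nat -> u n <= B1).
{ clear H. induction N as [|N [B1 IH]].
  - exists (u 0%nat). intros n Hn. replace n with 0%nat by lia. lra.
  - exists (Rmax B1 (u (S N))). intros n Hn.
    destruct (Nat.eq_dec n (S N)) as [->|Hne]. apply Rmax_r.
    eapply Rle_trans. apply IH. lia. apply Rmax_l. }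
destruct HN as [B1 HB1].
exists (Rmax (Rmax B B1) 1). split.
- eapply Rlt_le_trans; [|apply Rmax_r]. lra.
- intros n. eapply Rle_trans; [|apply Rmax_l].
  destruct (Compare_dec.le_lt_dec N n) as [Hle|Hlt].
  + eapply Rle_trans; [|apply Rmax_l]. auto.
  + eapply Rle_trans; [|apply Rmax_r]. apply HB1. lia.
Qed.

(** If the radius were smaller than [R0], convergence at a real point r between the two would bound
    |a_n| r^n, and such an r cannot exceed the radius. Passing to moduli gives a real series, and
    turns convergence on the disk into absolute convergence. *)
Lemma CV_radius_ge (a : nat -> C) (R0 : R) (f : C -> C) :
  0 < R0 -> (forall z, Cmod z < R0 -> C_pseries a z (f z)) ->
  Rbar_le R0 (CV_radius (fun n => Cmod (a n))).
Proof.
intros HR H.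
apply Rbar_not_lt_le. intros Hlt.
assert (Hge := CV_radius_ge_0 (fun n => Cmod (a n))).
destruct (CV_radius (fun n => Cmod (a n))) as [c| |] eqn:Ec; simpl in *; try tauto.
set (r := (c + R0) / 2).
destruct (CV_radius_bounded (fun n => Cmod (a n))) as [Hub _].
assert (Hr : Rbar_le r (CV_radius (fun n => Cmod (a n)))).
{ apply Hub.
  assert (Hz : Cmod (RtoC r) < R0).
  { rewrite Cmod_R, Rabs_pos_eq; unfold r; lra. }
  specialize (H _ Hz). rewrite C_pseries_series in H.
  destruct (C_series_lim_0 _ _ H 1 Rlt_0_1) as [N HN].
  destruct (eventually_bounded (fun n => Cmod (RtoC r ^ n * a n)%C) 1 N) as [B [_ HB]].
  intros n Hn. left. now apply HN.
  exists B. intros n. specialize (HB n). rewrite Cmod_mult, Cmod_pow, Cmod_R in HB.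
  rewrite Rabs_mult, (Rabs_pos_eq (Cmod (a n))) by apply Cmod_ge_0.
  rewrite <- RPow_abs. lra. }
rewrite Ec in Hr. simpl in Hr. unfold r in Hr. lra.
Qed.

(** The remainder of order n + 2 is (z + h) times the previous one plus (n + 1) h^2 z^n. Only
    nonnegative coefficients occur, so the triangle inequality replaces z and h by their moduli
    throughout. *)
Lemma Cmod_pow_taylor (z h : C) (n : nat) :
  Cmod ((z + h) ^ S n - z ^ S n - INR (S n) * h * z ^ n)%C <=
  (Cmod z + Cmod h) ^ S n - Cmod z ^ S n - INR (S n) * Cmod h * Cmod z ^ n.
Proof.
induction n as [|n IH].
- simpl. replace ((z + h) * 1 - z * 1 - 1 * h * 1)%C with (RtoC 0) by ring.
  rewrite Cmod_0. lra.
- replace ((z + h) ^ S (S n) - z ^ S (S n) - INR (S (S n)) * h * z ^ S n)%C with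
    ((z + h) * ((z + h) ^ S n - z ^ S n - INR (S n) * h * z ^ n) + INR (S n) * (h * h * z ^ n))%C.
  2:{ rewrite (S_INR (S n)), RtoC_plus. rewrite !(Cpow_S _ (S n)), (Cpow_S z n). ring. }
  eapply Rle_trans. apply Cmod_triangle. rewrite !Cmod_mult.
  rewrite Cmod_R, Cmod_pow, (Rabs_pos_eq (INR (S n))) by apply pos_INR.
  assert (Hzh := Cmod_triangle z h).
  assert (H1 : Cmod (z + h)%C * Cmod ((z + h) ^ S n - z ^ S n - INR (S n) * h * z ^ n)%C <=
     (Cmod z + Cmod h) * ((Cmod z + Cmod h) ^ S n - Cmod z ^ S n - INR (S n) * Cmod h * Cmod z ^ n)).
  { apply Rmult_le_compat; try apply Cmod_ge_0; assumption. }
  eapply Rle_trans. apply Rplus_le_compat_r. exact H1.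
  rewrite (S_INR (S n)). simpl pow. right. ring.
Qed.

Definition C_PS_derive (a : nat -> C) (n : nat) : C := (INR (S n) * a (S n))%C.

(* The remainder [f (z + h) - f z - h f' z] is dominated by the same remainder
   for the real series [sum |a_n| x^n], at [x = |z|] with increment [|h|]. *)
Lemma C_pseries_derive (a : nat -> C) (R0 : R) (f : C -> C) (z : C) :
  (forall z, Cmod z < R0 -> C_pseries a z (f z)) -> Cmod z < R0 ->
  exists l : C, C_pseries (C_PS_derive a) z l /\ C_is_derive f z l.
Proof.
intros H Hz.
assert (HR : 0 < R0). { eapply Rle_lt_trans; [apply Cmod_ge_0|exact Hz]. }
assert (HCV := CV_radius_ge a R0 f HR H).
set (A := fun n => Cmod (a n)) in *.
assert (HA : forall x, 0 <= x < R0 -> Rbar_lt (Rabs x) (CV_radius A)).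
{ intros x Hx. eapply Rbar_lt_le_trans; [|exact HCV]. simpl. rewrite Rabs_pos_eq; lra. }
assert (HzA := HA (Cmod z) (conj (Cmod_ge_0 z) Hz)).
destruct (ex_C_series_le (fun n => (z ^ n * C_PS_derive a n)%C)
   (fun n => PS_derive A n * Cmod z ^ n)) as [l Hl].
{ exact (proj1 (ex_pseries_R (PS_derive A) (Cmod z)) (ex_pseries_derive A (Cmod z) HzA)). }
{ intros n. unfold C_PS_derive, PS_derive, A. rewrite !Cmod_mult, Cmod_pow, Cmod_R.
  rewrite Rabs_pos_eq by apply pos_INR. right; ring. }
exists l. split. now apply C_pseries_series.
apply is_derive_C_eps. intros eps He.
assert (Hd := is_derive_PSeries A (Cmod z) HzA).
apply is_derive_Reals in Hd.
destruct (Hd eps He) as [delta Hdelta].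
exists (Rmin delta (R0 - Cmod z)). split.
{ apply Rmin_pos. apply cond_pos. lra. }
intros h Hh.
destruct (Req_dec (Cmod h) 0) as [Hh0|Hh0].
{ apply Cmod_eq_0 in Hh0. subst h. rewrite Cmod_0, Rmult_0_r.
  replace (z + 0)%C with z by ring. replace (f z - f z - 0 * l)%C with (RtoC 0) by ring.
  rewrite Cmod_0. lra. }
assert (Hhp : 0 < Cmod h). { generalize (Cmod_ge_0 h); lra. }
assert (Hh1 : Cmod h < delta) by (eapply Rlt_le_trans; [exact Hh|apply Rmin_l]).
assert (Hh2 : Cmod h < R0 - Cmod z) by (eapply Rlt_le_trans; [exact Hh|apply Rmin_r]).
specialize (Hdelta (Cmod h) Hh0). rewrite (Rabs_pos_eq (Cmod h)) in Hdelta by lra.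
specialize (Hdelta Hh1).
set (E := PSeries A (Cmod z + Cmod h) - PSeries A (Cmod z) - Cmod h * PSeries (PS_derive A) (Cmod z)).
apply Rle_trans with E.
2:{ replace E with (((PSeries A (Cmod z + Cmod h) - PSeries A (Cmod z)) / Cmod h - PSeries (PS_derive A) (Cmod z)) * Cmod h)
    by (unfold E; field; lra).
  apply Rmult_le_compat_r. lra. eapply Rle_trans; [apply Rle_abs|lra]. }
assert (Hzh : Cmod (z + h)%C < R0) by (eapply Rle_lt_trans; [apply Cmod_triangle|lra]).
apply Cmod_series_le with
  (a := fun n => ((z + h) ^ n * a n - z ^ n * a n - h * (match n with O => 0 | S m => z ^ m * C_PS_derive a m end))%C)
  (b := fun n => A n * (Cmod z + Cmod h) ^ n - A n * Cmod z ^ n - Cmod h * (match n with O => 0 | S m => PS_derive A m * Cmod z ^ m end)).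
- replace (h * l)%C with (l * h)%C by ring.
  apply C_series_minus. apply C_series_minus; apply (proj1 (C_pseries_series _ _ _)); now apply H.
  replace (l * h)%C with (h * (l + 0))%C by ring.
  set (u := fun n => match n with O => RtoC 0 | S m => (z ^ m * C_PS_derive a m)%C end).
  exact (C_series_scal h u (l + u 0%nat)%C (C_series_decr u l Hl)).
- unfold E.
  assert (S1 : forall x, 0 <= x < R0 -> is_series (fun n => A n * x ^ n) (PSeries A x)).
  { intros x Hx. exact (proj1 (is_pseries_R A x _) (PSeries_correct A x (CV_radius_inside A x (HA x Hx)))). }
  apply (is_series_minus (V := R_NormedModule)).
  apply (is_series_minus (V := R_NormedModule)); apply S1; generalize (Cmod_ge_0 z); lra.
  apply (is_series_scal (V := R_NormedModule) (Cmod h) (fun n => match n with O => 0 | S m => PS_derive A m * Cmod z ^ m end)).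
  apply (is_series_decr_1 (V := R_NormedModule)).
  change (is_series (fun k => PS_derive A k * Cmod z ^ k) (PSeries (PS_derive A) (Cmod z) + - 0)).
  rewrite Ropp_0, Rplus_0_r.
  exact (proj1 (is_pseries_R (PS_derive A) _ _) (PSeries_correct _ _ (ex_pseries_derive A _ HzA))).
- intros [|n].
  + replace ((z + h) ^ 0 * a 0%nat - z ^ 0 * a 0%nat - h * 0)%C with (RtoC 0) by (simpl; ring).
    rewrite Cmod_0. simpl. lra.
  + unfold C_PS_derive, PS_derive, A.
    replace ((z + h) ^ S n * a (S n) - z ^ S n * a (S n) - h * (z ^ n * (INR (S n) * a (S n))))%C
      with (a (S n) * ((z + h) ^ S n - z ^ S n - INR (S n) * h * z ^ n))%C by ring.
    rewrite Cmod_mult.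
    eapply Rle_trans. apply Rmult_le_compat_l. apply Cmod_ge_0. apply Cmod_pow_taylor.
    right; ring.
Qed.

(** * Cauchy's formula and Taylor expansion on a disk *)

(** The parameter is real and the values are complex. Working by components makes the real theory of
    derivatives and integrals available for each coordinate. *)
Definition path_derive (g : R -> C) (t : R) (d : C) : Prop :=
  is_derive (fun s => Re (g s)) t (Re d) /\ is_derive (fun s => Im (g s)) t (Im d).

Lemma is_derive_R_eps (f : R -> R) (x l : R) :
  is_derive f x l <->
  forall eps : R, 0 < eps -> exists delta : R, 0 < delta /\
    forall h : R, Rabs h < delta -> Rabs (f (x + h) - f x - h * l) <= eps * Rabs h.
Proof.
rewrite is_derive_Reals. split; intros H eps He.
- destruct (H eps He) as [d Hd]. exists d. split. apply cond_pos.
  intros h Hh. destruct (Req_dec h 0) as [->|Hn].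
  + rewrite Rplus_0_r. replace (f x - f x - 0 * l) with 0 by ring. rewrite Rabs_R0. lra.
  + specialize (Hd h Hn Hh).
    replace (f (x + h) - f x - h * l) with (((f (x + h) - f x) / h - l) * h) by (field; auto).
    rewrite Rabs_mult. apply Rmult_le_compat_r. apply Rabs_pos. lra.
- destruct (H (eps / 2)) as [d [Hd0 Hd]]. lra.
  exists (mkposreal d Hd0). intros h Hn Hh. specialize (Hd h Hh).
  replace ((f (x + h) - f x) / h - l) with ((f (x + h) - f x - h * l) / h) by (field; auto).
  unfold Rdiv at 1. rewrite Rabs_mult, Rabs_inv.
  assert (Hp := Rabs_pos_lt h Hn).
  apply Rmult_lt_reg_r with (Rabs h). exact Hp.
  rewrite Rmult_assoc, Rinv_l by lra. nra.
Qed.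

Lemma path_derive_eps (g : R -> C) (t : R) (d : C) :
  path_derive g t d <->
  forall eps : R, 0 < eps -> exists delta : R, 0 < delta /\
    forall h : R, Rabs h < delta -> Cmod (g (t + h)%R - g t - h * d)%C <= eps * Rabs h.
Proof.
unfold path_derive. rewrite !is_derive_R_eps.
assert (HR : forall h, Re (g (t + h)%R - g t - h * d)%C = Re (g (t + h)) - Re (g t) - h * Re d).
{ intros h. unfold Cminus. rewrite !re_plus, !re_opp, re_scal_l. ring. }
assert (HI : forall h, Im (g (t + h)%R - g t - h * d)%C = Im (g (t + h)) - Im (g t) - h * Im d).
{ intros h. unfold Cminus. rewrite !im_plus, !im_opp, im_scal_l. ring. }
split.
- intros [H1 H2] eps He.
  destruct (H1 (eps / 2)) as [d1 [Hd1 H1']]. lra.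
  destruct (H2 (eps / 2)) as [d2 [Hd2 H2']]. lra.
  exists (Rmin d1 d2). split. now apply Rmin_pos.
  intros h Hh. eapply Rle_trans. apply Cmod_le_re_im.
  rewrite HR, HI.
  generalize (H1' h (Rlt_le_trans _ _ _ Hh (Rmin_l _ _))) (H2' h (Rlt_le_trans _ _ _ Hh (Rmin_r _ _))).
  lra.
- intros H; split; intros eps He; destruct (H eps He) as [d0 [Hd0 H']]; exists d0; split; auto;
    intros h Hh; (eapply Rle_trans; [|exact (H' h Hh)]).
  rewrite <- HR. apply re_le_Cmod.
  rewrite <- HI. apply im_le_Cmod.
Qed.

Lemma path_derive_comp (f : C -> C) (g : R -> C) (t : R) (l d : C) :
  C_is_derive f (g t) l -> path_derive g t d -> path_derive (fun s => f (g s)) t (l * d)%C.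
Proof.
rewrite is_derive_C_eps, !path_derive_eps. intros Hf Hg eps He.
assert (HL := Cmod_ge_0 l). assert (HD := Cmod_ge_0 d).
(* The cap 1 keeps the increment of g below (|d| + 1) |h|; the second entry makes |l| [e1] at most
   eps / 2. *)
set (e1 := Rmin 1 (eps / (2 * (Cmod l + 1)))).
assert (He1 : 0 < e1). { apply Rmin_pos. lra. apply Rdiv_lt_0_compat; lra. }
destruct (Hg e1 He1) as [d1 [Hd1 Hg']].
destruct (Hf (eps / (2 * (Cmod d + 1)))) as [d2 [Hd2 Hf']]. apply Rdiv_lt_0_compat; lra.
exists (Rmin d1 (d2 / (Cmod d + 1))). split.
{ apply Rmin_pos. lra. apply Rdiv_lt_0_compat; lra. }
intros h Hh.
specialize (Hg' h (Rlt_le_trans _ _ _ Hh (Rmin_l _ _))).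
assert (Hh2 := Rlt_le_trans _ _ _ Hh (Rmin_r _ _)).
set (k := (g (t + h)%R - g t)%C).
assert (Hk : Cmod k <= (Cmod d + 1) * Rabs h).
{ replace k with ((g (t + h)%R - g t - h * d) + h * d)%C by (unfold k; ring).
  eapply Rle_trans. apply Cmod_triangle. rewrite Cmod_mult, Cmod_R.
  assert (e1 <= 1) by apply Rmin_l. assert (Hp := Rabs_pos h). nra. }
assert (Hk2 : Cmod k < d2).
{ eapply Rle_lt_trans. exact Hk.
  apply Rmult_lt_reg_r with (/ (Cmod d + 1)). apply Rinv_0_lt_compat; lra.
  unfold Rdiv in Hh2. replace ((Cmod d + 1) * Rabs h * / (Cmod d + 1)) with (Rabs h) by (field; lra). exact Hh2. }
specialize (Hf' k Hk2).
replace (g t + k)%C with (g (t + h)) in Hf' by (unfold k; ring).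
replace (f (g (t + h)%R) - f (g t) - h * (l * d))%C with
  ((f (g (t + h)%R) - f (g t) - k * l) + l * (g (t + h)%R - g t - h * d))%C by (unfold k; ring).
eapply Rle_trans. apply Cmod_triangle. rewrite Cmod_mult.
assert (B1 : eps / (2 * (Cmod d + 1)) * Cmod k <= eps / 2 * Rabs h).
{ replace (eps / 2 * Rabs h) with (eps / (2 * (Cmod d + 1)) * ((Cmod d + 1) * Rabs h)) by (field; lra).
  apply Rmult_le_compat_l. left; apply Rdiv_lt_0_compat; lra. exact Hk. }
assert (B2 : Cmod l * Cmod (g (t + h)%R - g t - h * d)%C <= eps / 2 * Rabs h).
{ eapply Rle_trans. apply Rmult_le_compat_l. exact HL. exact Hg'.
  assert (He2 : e1 <= eps / (2 * (Cmod l + 1))) by apply Rmin_r.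
  rewrite <- Rmult_assoc. apply Rmult_le_compat_r. apply Rabs_pos.
  apply Rle_trans with (Cmod l * (eps / (2 * (Cmod l + 1)))). now apply Rmult_le_compat_l.
  replace (eps / 2) with ((Cmod l + 1) * (eps / (2 * (Cmod l + 1)))) by (field; lra).
  apply Rmult_le_compat_r. left; apply Rdiv_lt_0_compat; lra. lra. }
lra.
Qed.

Lemma path_derive_scal (k : C) (g : R -> C) (t : R) (d : C) :
  path_derive g t d -> path_derive (fun s => (k * g s)%C) t (k * d)%C.
Proof.
intros H. apply (path_derive_comp (fun z => (k * z)%C)); [|exact H].
apply is_derive_C_eps. intros eps He. exists 1. split. lra.
intros h _. replace (k * (g t + h) - k * g t - h * k)%C with (RtoC 0) by ring.
rewrite Cmod_0. generalize (Cmod_ge_0 h); nra.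
Qed.

Lemma path_derive_affine (z w : C) (t : R) : path_derive (fun s : R => (z + s * w)%C) t w.
Proof.
apply path_derive_eps. intros eps He. exists 1. split. lra.
intros h _. replace (z + (t + h)%R * w - (z + t * w) - h * w)%C with (RtoC 0)
  by (rewrite RtoC_plus; ring).
rewrite Cmod_0. generalize (Rabs_pos h); nra.
Qed.

Lemma path_derive_plus_const (k : C) (g : R -> C) (t : R) (d : C) :
  path_derive g t d -> path_derive (fun s => (k + g s)%C) t d.
Proof.
rewrite !path_derive_eps. intros H eps He. destruct (H eps He) as [d0 [H0 H1]].
exists d0. split; auto. intros h Hh.
replace (k + g (t + h)%R - (k + g t) - h * d)%C with (g (t + h)%R - g t - h * d)%C by ring. auto.
Qed.

(** The domain is left general because both paths on R and functions of the pair (s, t) on R * R are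
    needed. *)
Definition C_continuous {U : UniformSpace} (h : U -> C) (x : U) : Prop :=
  continuous (fun y => Re (h y)) x /\ continuous (fun y => Im (h y)) x.

Lemma C_continuous_const {U : UniformSpace} (c : C) (x : U) : C_continuous (fun _ => c) x.
Proof. split; apply continuous_const. Qed.

Lemma C_continuous_plus {U : UniformSpace} (g h : U -> C) (x : U) :
  C_continuous g x -> C_continuous h x -> C_continuous (fun y => (g y + h y)%C) x.
Proof.
intros [H1 H2] [H3 H4]. split.
- apply continuous_ext with (fun y => Re (g y) + Re (h y)).
  intros; now rewrite re_plus. now apply (continuous_plus (V := R_NormedModule)).
- apply continuous_ext with (fun y => Im (g y) + Im (h y)).
  intros; now rewrite im_plus. now apply (continuous_plus (V := R_NormedModule)).
Qed.

Lemma C_continuous_mult {U : UniformSpace} (g h : U -> C) (x : U) :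
  C_continuous g x -> C_continuous h x -> C_continuous (fun y => (g y * h y)%C) x.
Proof.
intros [H1 H2] [H3 H4]. split.
- apply continuous_ext with (fun y => Re (g y) * Re (h y) - Im (g y) * Im (h y)).
  intros; now rewrite re_mult.
  apply (continuous_minus (V := R_NormedModule)); now apply (continuous_mult (K := R_AbsRing)).
- apply continuous_ext with (fun y => Re (g y) * Im (h y) + Im (g y) * Re (h y)).
  intros; now rewrite im_mult.
  apply (continuous_plus (V := R_NormedModule)); now apply (continuous_mult (K := R_AbsRing)).
Qed.

Definition C_continuous_eps (f : C -> C) (z : C) : Prop :=
  forall eps : R, 0 < eps -> exists delta : R, 0 < delta /\
    forall w : C, Cmod (w - z)%C < delta -> Cmod (f w - f z)%C < eps.

Lemma C_continuous_comp {U : UniformSpace} (f : C -> C) (h : U -> C) (x : U) :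
  C_continuous h x -> C_continuous_eps f (h x) -> C_continuous (fun y => f (h y)) x.
Proof.
intros [H1 H2] Hf.
assert (K : forall eps : posreal, locally x (fun y => Cmod (f (h y) - f (h x))%C < eps)).
{ intros eps. destruct (Hf eps (cond_pos eps)) as [d [Hd Hf']].
  assert (Hd2 : 0 < d / 2) by lra.
  assert (L1 := proj1 (filterlim_locally _ _) H1 (mkposreal _ Hd2)).
  assert (L2 := proj1 (filterlim_locally _ _) H2 (mkposreal _ Hd2)).
  generalize (filter_and _ _ L1 L2). apply filter_imp.
  intros y [B1 B2]. apply Hf'.
  change (Rabs (Re (h y) - Re (h x)) < d / 2) in B1.
  change (Rabs (Im (h y) - Im (h x)) < d / 2) in B2.
  eapply Rle_lt_trans. apply Cmod_le_re_im.
  unfold Cminus. rewrite re_plus, im_plus, re_opp, im_opp. unfold Rminus in *. lra. }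
split; apply filterlim_locally; intros eps; generalize (K eps); apply filter_imp;
  intros y Hy; (eapply Rle_lt_trans; [|exact Hy]).
- change (Rabs (Re (f (h y)) - Re (f (h x))) <= Cmod (f (h y) - f (h x))%C).
  unfold Rminus. rewrite <- re_opp, <- re_plus. apply re_le_Cmod.
- change (Rabs (Im (f (h y)) - Im (f (h x))) <= Cmod (f (h y) - f (h x))%C).
  unfold Rminus. rewrite <- im_opp, <- im_plus. apply im_le_Cmod.
Qed.

Lemma C_derive_continuous_eps (f : C -> C) (z l : C) : C_is_derive f z l -> C_continuous_eps f z.
Proof.
rewrite is_derive_C_eps. intros H eps He.
destruct (H 1 Rlt_0_1) as [d [Hd H']].
assert (HL := Cmod_ge_0 l).
exists (Rmin d (eps / (Cmod l + 1))). split.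
{ apply Rmin_pos. lra. apply Rdiv_lt_0_compat; lra. }
intros w Hw. specialize (H' (w - z)%C (Rlt_le_trans _ _ _ Hw (Rmin_l _ _))).
assert (Hw2 := Rlt_le_trans _ _ _ Hw (Rmin_r _ _)).
rewrite Cplus_minus in H'.
replace (f w - f z)%C with ((f w - f z - (w - z) * l) + (w - z) * l)%C by ring.
eapply Rle_lt_trans. apply Cmod_triangle. rewrite Cmod_mult.
apply Rle_lt_trans with ((Cmod l + 1) * Cmod (w - z)%C). lra.
apply Rmult_lt_reg_r with (/ (Cmod l + 1)). apply Rinv_0_lt_compat; lra.
unfold Rdiv in Hw2.
replace ((Cmod l + 1) * Cmod (w - z)%C * / (Cmod l + 1)) with (Cmod (w - z)%C) by (field; lra). exact Hw2.
Qed.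

(** The derivative in s of the integral of [u s] is the integral of [du s], which equals v s b - v s
    a = 0 because [du] is also a derivative in t. The margin [eta] makes s = 0 and s = 1 interior
    points for differentiation under the integral sign. *)
Lemma RInt_homotopy (u du v : R -> R -> R) (a b eta : R) :
  0 < eta -> a <= b ->
  (forall s t, - eta < s < 1 + eta -> is_derive (fun s => u s t) s (du s t)) ->
  (forall s t, - eta < s < 1 + eta -> is_derive (v s) t (du s t)) ->
  (forall s t, - eta < s < 1 + eta ->
     continuous (fun p : R * R => du (fst p) (snd p)) (s, t)) ->
  (forall s t, - eta < s < 1 + eta -> continuous (u s) t) ->
  (forall s, v s a = v s b) ->
  RInt (u 0) a b = RInt (u 1) a b.
Proof.
intros Heta Hab Hu Hv Hdu Hcu Hper.
assert (Hloc : forall s, - eta < s < 1 + eta -> locally s (fun y => - eta < y < 1 + eta)).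
{ intros s Hs.
  assert (P : 0 < Rmin (s + eta) (1 + eta - s)) by (apply Rmin_pos; lra).
  exists (mkposreal _ P). intros y Hy. change (Rabs (y - s) < Rmin (s + eta) (1 + eta - s)) in Hy.
  apply Rabs_def2 in Hy. generalize (Rmin_l (s + eta) (1 + eta - s)) (Rmin_r (s + eta) (1 + eta - s)). lra. }
assert (D : forall s, - eta < s < 1 + eta -> is_derive (fun s => RInt (u s) a b) s 0).
{ intros s Hs.
  replace 0 with (RInt (fun t => Derive (fun z => u z t) s) a b).
  2:{ rewrite RInt_ext with (g := du s).
      2:{ intros t _. apply is_derive_unique. now apply Hu. }
      replace 0 with (v s b - v s a) by (rewrite (Hper s); ring).
      apply is_RInt_unique. apply (is_RInt_derive (V := R_CompleteNormedModule) (v s) (du s)).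
      intros t _. now apply Hv.
      intros t _. apply (continuous_comp (fun t => (s, t)) (fun p : R * R => du (fst p) (snd p))).
      2: now apply Hdu.
      apply (continuous_comp_2 (fun _ : R => s) (fun t : R => t) (fun x y => (x, y))).
      apply continuous_const. apply continuous_id.
      apply continuous_ext with (fun p => p). now intros []. apply continuous_id. }
  apply is_derive_RInt_param.
  - generalize (Hloc s Hs). apply filter_imp. intros y Hy t _. exists (du y t). now apply Hu.
  - intros t _. apply continuity_2d_pt_ext_loc with (f := du).
    + destruct (Hloc s Hs) as [d Hd]. exists d. intros y w Hy _.
      symmetry. apply is_derive_unique. apply Hu. apply Hd. exact Hy.
    + apply continuity_2d_pt_filterlim. now apply Hdu.
  - generalize (Hloc s Hs). apply filter_imp. intros y Hy.
    apply (ex_RInt_continuous (V := R_CompleteNormedModule)). intros t _. now apply Hcu. }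
destruct (MVT_gen (fun s => RInt (u s) a b) 0 1 (fun _ => 0)) as [c [_ Hc]].
- intros x Hx. rewrite Rmin_left, Rmax_right in Hx by lra. apply D. lra.
- intros x Hx. rewrite Rmin_left, Rmax_right in Hx by lra.
  apply derivable_continuous_pt. exists 0. apply is_derive_Reals. apply D. lra.
- rewrite Rmult_0_l in Hc. lra.
Qed.

(** * Means over circles and the Cauchy kernel *)

Definition circ (r t : R) : C := (r * cos t, r * sin t).

Lemma Cmod_circ (r t : R) : 0 <= r -> Cmod (circ r t) = r.
Proof.
intros Hr. unfold Cmod, circ; simpl.
replace (r * cos t * (r * cos t * 1) + r * sin t * (r * sin t * 1))
  with (r² * ((sin t)² + (cos t)²)) by (unfold Rsqr; ring).
rewrite sin2_cos2, Rmult_1_r. now apply sqrt_Rsqr.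
Qed.

Lemma circ_period (r : R) : circ r 0 = circ r (2 * PI).
Proof. unfold circ. now rewrite sin_0, cos_0, sin_2PI, cos_2PI. Qed.

Lemma path_derive_circ (r t : R) : path_derive (circ r) t (Ci * circ r t)%C.
Proof.
split.
- replace (Re (Ci * circ r t)) with (r * - sin t) by (unfold Ci, circ; simpl; ring).
  simpl. apply is_derive_scal. apply is_derive_Reals, derivable_pt_lim_cos.
- replace (Im (Ci * circ r t)) with (r * cos t) by (unfold Ci, circ; simpl; ring).
  simpl. apply is_derive_scal. apply is_derive_Reals, derivable_pt_lim_sin.
Qed.

Lemma C_continuous_circ (r t : R) : C_continuous (circ r) t.
Proof.
destruct (path_derive_circ r t) as [H1 H2].
split; apply (ex_derive_continuous (V := R_NormedModule)); eexists; [exact H1|exact H2].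
Qed.

Lemma Cinv_continuous_eps (w : C) : w <> RtoC 0 -> C_continuous_eps Cinv w.
Proof.
intros Hw eps He.
assert (Hm := proj1 (Cmod_gt_0 w) Hw).
exists (Rmin (Cmod w / 2) (eps * (Cmod w * Cmod w) / 2)). split.
{ apply Rmin_pos. lra. assert (0 < Cmod w * Cmod w) by nra. nra. }
intros v Hv.
assert (H1 := Rlt_le_trans _ _ _ Hv (Rmin_l _ _)).
assert (H2 := Rlt_le_trans _ _ _ Hv (Rmin_r _ _)).
assert (Hvm : Cmod w / 2 < Cmod v).
{ assert (T := Cmod_triangle v (w - v)%C). rewrite Cplus_minus in T.
  replace (w - v)%C with (- (v - w))%C in T by ring. rewrite Cmod_opp in T. lra. }
assert (Hv0 : v <> RtoC 0).
{ intros ->. rewrite Cmod_0 in Hvm. lra. }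
replace (/ v - / w)%C with (- (v - w) * / (v * w))%C by (field; auto).
rewrite Cmod_mult, Cmod_opp, Cmod_inv, Cmod_mult by now apply Cmult_neq_0.
apply Rmult_lt_reg_r with (Cmod v * Cmod w). nra.
rewrite Rmult_assoc, Rinv_l, Rmult_1_r by nra.
apply Rlt_le_trans with (1 := H2).
replace (eps * (Cmod w * Cmod w) / 2) with (eps * (Cmod w / 2 * Cmod w)) by field.
apply Rmult_le_compat_l. lra. apply Rmult_le_compat_r; lra.
Qed.

(** With w = [circ r t] this is the contour integral of h dw / (2 pi i w), so Cauchy's integral
    becomes a mean over one period. *)
Definition cmean (h : R -> C) : C :=
  (RInt (fun t => Re (h t)) 0 (2 * PI) / (2 * PI), RInt (fun t => Im (h t)) 0 (2 * PI) / (2 * PI)).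

Lemma two_PI_pos : 0 < 2 * PI.
Proof. generalize PI_RGT_0; lra. Qed.

Lemma ex_RInt_re (h : R -> C) (a b : R) :
  (forall t, C_continuous h t) -> ex_RInt (fun t => Re (h t)) a b.
Proof. intros H. apply (ex_RInt_continuous (V := R_CompleteNormedModule)). intros t _. exact (proj1 (H t)). Qed.

Lemma ex_RInt_im (h : R -> C) (a b : R) :
  (forall t, C_continuous h t) -> ex_RInt (fun t => Im (h t)) a b.
Proof. intros H. apply (ex_RInt_continuous (V := R_CompleteNormedModule)). intros t _. exact (proj2 (H t)). Qed.

Lemma cmean_ext (g h : R -> C) : (forall t, g t = h t) -> cmean g = cmean h.
Proof.
intros H. unfold cmean. do 2 f_equal; apply RInt_ext; intros t _; now rewrite H.
Qed.

Lemma cmean_plus (g h : R -> C) :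
  (forall t, C_continuous g t) -> (forall t, C_continuous h t) ->
  cmean (fun t => (g t + h t)%C) = (cmean g + cmean h)%C.
Proof.
intros Hg Hh. unfold cmean. apply injective_projections; simpl.
- rewrite (RInt_ext _ (fun t => plus (Re (g t)) (Re (h t)))) by (intros; apply re_plus).
  rewrite (RInt_plus (V := R_CompleteNormedModule)) by now apply ex_RInt_re.
  change plus with Rplus. field. apply Rgt_not_eq, PI_RGT_0.
- rewrite (RInt_ext _ (fun t => plus (Im (g t)) (Im (h t)))) by (intros; apply im_plus).
  rewrite (RInt_plus (V := R_CompleteNormedModule)) by now apply ex_RInt_im.
  change plus with Rplus. field. apply Rgt_not_eq, PI_RGT_0.
Qed.

Lemma cmean_scal (c : C) (h : R -> C) :
  (forall t, C_continuous h t) -> cmean (fun t => (c * h t)%C) = (c * cmean h)%C.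
Proof.
intros Hh.
assert (E : forall x y, RInt (fun t => x * Re (h t) + y * Im (h t)) 0 (2 * PI) =
   x * RInt (fun t => Re (h t)) 0 (2 * PI) + y * RInt (fun t => Im (h t)) 0 (2 * PI)).
{ intros x y.
  rewrite (RInt_plus (V := R_CompleteNormedModule) (fun t => x * Re (h t)) (fun t => y * Im (h t))).
  - rewrite (RInt_scal (V := R_CompleteNormedModule) (fun t => Re (h t))) by now apply ex_RInt_re.
    rewrite (RInt_scal (V := R_CompleteNormedModule) (fun t => Im (h t))) by now apply ex_RInt_im.
    reflexivity.
  - apply (ex_RInt_scal (V := R_NormedModule)). now apply ex_RInt_re.
  - apply (ex_RInt_scal (V := R_NormedModule)). now apply ex_RInt_im. }
unfold cmean. apply injective_projections; simpl.
- rewrite (RInt_ext _ (fun t => fst c * Re (h t) + - snd c * Im (h t))).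
  2:{ intros t _. unfold Re, Im. simpl. ring. }
  rewrite E. field. apply Rgt_not_eq, PI_RGT_0.
- rewrite (RInt_ext _ (fun t => snd c * Re (h t) + fst c * Im (h t))).
  2:{ intros t _. unfold Re, Im. simpl. ring. }
  rewrite E. field. apply Rgt_not_eq, PI_RGT_0.
Qed.

(** The factor 2 comes from bounding the two components separately. It is harmless in the geometric
    remainder where the bound is applied. *)
Lemma cmean_bound (h : R -> C) (B : R) :
  (forall t, C_continuous h t) -> (forall t, 0 <= t <= 2 * PI -> Cmod (h t) <= B) -> Cmod (cmean h) <= 2 * B.
Proof.
intros Hh HB.
assert (HP := two_PI_pos).
assert (K : forall u : R -> R, ex_RInt u 0 (2 * PI) -> (forall t, 0 <= t <= 2 * PI -> Rabs (u t) <= B) ->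
   Rabs (RInt u 0 (2 * PI) / (2 * PI)) <= B).
{ intros u Hu Hb. unfold Rdiv. rewrite Rabs_mult, Rabs_inv, (Rabs_pos_eq (2 * PI)) by lra.
  apply Rmult_le_reg_r with (2 * PI). lra. rewrite Rmult_assoc, Rinv_l, Rmult_1_r by lra.
  eapply Rle_trans. apply (abs_RInt_le_const u 0 (2 * PI) B). lra. exact Hu.
  intros; now apply Hb. right; ring. }
eapply Rle_trans. apply Cmod_le_re_im. unfold cmean, Re at 1, Im at 1; simpl.
generalize (K _ (ex_RInt_re h 0 (2 * PI) Hh) (fun t Ht => Rle_trans _ _ _ (re_le_Cmod _) (HB t Ht))).
generalize (K _ (ex_RInt_im h 0 (2 * PI) Hh) (fun t Ht => Rle_trans _ _ _ (im_le_Cmod _) (HB t Ht))).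
lra.
Qed.

Lemma circ_mult (r s t u : R) : (circ r t * circ s u)%C = circ (r * s) (t + u).
Proof.
unfold circ. rewrite cos_plus, sin_plus. apply injective_projections; simpl; ring.
Qed.

Lemma Cinv_circ_pow (r t : R) (n : nat) :
  0 < r -> ((/ circ r t) ^ n)%C = circ ((/ r) ^ n) (- (INR n * t)).
Proof.
intros Hr.
assert (H1 : (/ circ r t)%C = circ (/ r) (- t)).
{ assert (Hc : circ r t <> RtoC 0).
  { apply Cmod_gt_0. rewrite Cmod_circ; lra. }
  replace (circ (/ r) (- t)) with (/ circ r t * (circ r t * circ (/ r) (- t)))%C by (field; auto).
  rewrite circ_mult, Rplus_opp_r, Rinv_r by lra. unfold circ. rewrite cos_0, sin_0.
  replace (1 * 1, 1 * 0) with (RtoC 1) by (apply injective_projections; simpl; ring). ring. }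
induction n as [|n IH].
- simpl. unfold circ. rewrite Rmult_0_l, Ropp_0, cos_0, sin_0. apply injective_projections; simpl; ring.
- rewrite Cpow_S, IH, H1, S_INR, circ_mult. simpl pow. f_equal. ring.
Qed.

Lemma cmean_inv_circ_pow (r : R) (n : nat) :
  0 < r -> (0 < n)%nat -> cmean (fun t => ((/ circ r t) ^ n)%C) = RtoC 0.
Proof.
intros Hr Hn.
assert (Hn' : 0 < INR n) by now apply lt_0_INR.
set (q := (/ r) ^ n).
assert (Hs : sin (INR n * (2 * PI)) = 0).
{ replace (INR n * (2 * PI)) with (0 + 2 * INR n * PI) by ring. now rewrite sin_period, sin_0. }
assert (Hc : cos (INR n * (2 * PI)) = 1).
{ replace (INR n * (2 * PI)) with (0 + 2 * INR n * PI) by ring. now rewrite cos_period, cos_0. }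
unfold cmean. apply injective_projections; simpl.
- rewrite (RInt_ext _ (fun t => q * cos (INR n * t))).
  2:{ intros t _. rewrite Cinv_circ_pow by exact Hr. fold q. simpl. rewrite ?cos_neg, ?sin_neg. ring. }
  rewrite (is_RInt_unique _ _ _ 0). field; apply Rgt_not_eq, PI_RGT_0.
  assert (E : minus (q * sin (INR n * (2 * PI)) / INR n) (q * sin (INR n * 0) / INR n) = 0).
  { rewrite Hs, (Rmult_0_r (INR n)), sin_0. unfold minus, plus, opp; simpl. field. lra. }
  rewrite <- E at 2.
  apply (is_RInt_derive (V := R_CompleteNormedModule) (fun t => q * sin (INR n * t) / INR n)).
  + intros x _. auto_derive. auto. field. lra.
  + intros x _. apply (ex_derive_continuous (V := R_NormedModule)). auto_derive. auto.
- rewrite (RInt_ext _ (fun t => q * - sin (INR n * t))).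
  2:{ intros t _. rewrite Cinv_circ_pow by exact Hr. fold q. simpl. rewrite ?cos_neg, ?sin_neg. ring. }
  rewrite (is_RInt_unique _ _ _ 0). field; apply Rgt_not_eq, PI_RGT_0.
  assert (E : minus (q * cos (INR n * (2 * PI)) / INR n) (q * cos (INR n * 0) / INR n) = 0).
  { rewrite Hc, (Rmult_0_r (INR n)), cos_0. unfold minus, plus, opp; simpl. field. lra. }
  rewrite <- E at 2.
  apply (is_RInt_derive (V := R_CompleteNormedModule) (fun t => q * cos (INR n * t) / INR n)).
  + intros x _. auto_derive. auto. field. lra.
  + intros x _. apply (ex_derive_continuous (V := R_NormedModule)). auto_derive. auto.
Qed.

Lemma cmean_const (c : C) : cmean (fun _ => c) = c.
Proof.
unfold cmean. apply injective_projections; simpl;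
  rewrite RInt_const; unfold scal; simpl; unfold mult; simpl; unfold Re, Im; field;
  apply Rgt_not_eq, PI_RGT_0.
Qed.

Section Kernel.

Context (r : R) (z : C) (Hz : Cmod z < r).

(** The Cauchy kernel dw / (w - z) with dw = i w dt: the factor w in the numerator comes from the
    parametrisation. *)
Definition kernel (t : R) : C := (circ r t / (circ r t - z))%C.

Lemma radius_pos : 0 < r.
Proof. eapply Rle_lt_trans; [apply Cmod_ge_0|exact Hz]. Qed.

Lemma circ_ne_0 (t : R) : circ r t <> RtoC 0.
Proof. apply Cmod_gt_0. rewrite Cmod_circ; generalize radius_pos; lra. Qed.

Lemma Cmod_circ_minus (t : R) : r - Cmod z <= Cmod (circ r t - z)%C.
Proof.
assert (T := Cmod_triangle (circ r t - z) z).
replace (circ r t - z + z)%C with (circ r t) in T by ring.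
rewrite Cmod_circ in T by (generalize radius_pos; lra). lra.
Qed.

Lemma circ_minus_ne_0 (t : R) : (circ r t - z)%C <> RtoC 0.
Proof. apply Cmod_gt_0. generalize (Cmod_circ_minus t). lra. Qed.

Lemma kernel_continuous (t : R) : C_continuous kernel t.
Proof.
apply (C_continuous_mult (circ r) (fun t => / (circ r t - z))%C).
apply C_continuous_circ.
apply (C_continuous_comp Cinv (fun t => circ r t - z)%C).
apply (C_continuous_plus (circ r) (fun _ => - z)%C).
apply C_continuous_circ. apply C_continuous_const.
apply Cinv_continuous_eps, circ_minus_ne_0.
Qed.

Lemma inv_circ_pow_continuous (n : nat) (t : R) : C_continuous (fun t => (/ circ r t) ^ n)%C t.
Proof.
induction n as [|n IH]. apply C_continuous_const.
apply (C_continuous_mult (fun t => / circ r t)%C (fun t => (/ circ r t) ^ n)%C); [|exact IH].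
apply (C_continuous_comp Cinv (circ r)). apply C_continuous_circ.
apply Cinv_continuous_eps, circ_ne_0.
Qed.

Lemma Cmod_kernel (t : R) : Cmod (kernel t) <= r / (r - Cmod z).
Proof.
unfold kernel. rewrite Cmod_div by apply circ_minus_ne_0. rewrite Cmod_circ by (generalize radius_pos; lra).
apply Rmult_le_compat_l. generalize radius_pos; lra.
apply Rinv_le_contravar. lra. apply Cmod_circ_minus.
Qed.

(** Iterating w / (w - z) = 1 + (z / w) w / (w - z) under the mean gives a finite expansion with an
    exact remainder, of size O((|z| / r)^(N + 1)). Sum and integral are thus never interchanged. *)
Lemma cmean_kernel_pseries (h : R -> C) (B : R) :
  (forall t, C_continuous h t) -> (forall t, 0 <= t <= 2 * PI -> Cmod (h t) <= B) ->
  C_pseries (fun n => cmean (fun t => (h t * (/ circ r t) ^ n)%C)) z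
    (cmean (fun t => (h t * kernel t)%C)).
Proof.
intros Hh HB. assert (Hr := radius_pos).
assert (HB0 : 0 <= B). { eapply Rle_trans; [apply Cmod_ge_0|apply (HB 0); generalize two_PI_pos; lra]. }
set (g := fun (n : nat) (t : R) => (h t * (/ circ r t) ^ n)%C).
assert (Cg : forall n t, C_continuous (g n) t).
{ intros n t. apply (C_continuous_mult h); auto. apply inv_circ_pow_continuous. }
assert (Cgk : forall n t, C_continuous (fun t => g n t * kernel t)%C t).
{ intros n t. apply (C_continuous_mult (g n)); auto. apply kernel_continuous. }
assert (Hstep : forall n, cmean (fun t => (g n t * kernel t)%C) =
  (cmean (g n) + z * cmean (fun t => (g (S n) t * kernel t)%C))%C).
{ intros n. rewrite <- cmean_scal by apply Cgk.
  rewrite <- cmean_plus; auto.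
  2:{ intros t. apply (C_continuous_mult (fun _ => z)). apply C_continuous_const. apply Cgk. }
  apply cmean_ext. intros t. unfold g, kernel. rewrite Cpow_S.
  field. split. apply circ_minus_ne_0. apply circ_ne_0. }
assert (Hsum : forall N, cmean (fun t => (h t * kernel t)%C) =
  (C_sum (fun k => z ^ k * cmean (g k)) N + z ^ S N * cmean (fun t => (g (S N) t * kernel t)%C))%C).
{ intros N. replace (cmean (fun t => (h t * kernel t)%C)) with (cmean (fun t => (g 0%nat t * kernel t)%C)).
  2:{ apply cmean_ext. intros t. unfold g. simpl. ring. }
  induction N as [|N IH].
  - rewrite C_sum_0, Hstep. simpl. ring.
  - rewrite C_sum_S, IH, (Hstep (S N)), (Cpow_S z (S N)). ring. }
apply C_pseries_series. apply is_series_C_eps. intros eps He.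
set (q := Cmod z / r).
assert (Hq : 0 <= q < 1).
{ unfold q. split. apply Rmult_le_pos. apply Cmod_ge_0. left; now apply Rinv_0_lt_compat.
  apply Rmult_lt_reg_r with r. auto. unfold Rdiv. rewrite Rmult_assoc, Rinv_l; lra. }
set (K := 2 * (B * (r / (r - Cmod z)))).
assert (HK : 0 <= K).
{ unfold K. apply Rmult_le_pos. lra. apply Rmult_le_pos. lra. left; apply Rdiv_lt_0_compat; lra. }
destruct (pow_lt_1_zero q ltac:(rewrite Rabs_pos_eq; lra) (eps / (K + 1))) as [N HN].
apply Rdiv_lt_0_compat; lra.
exists N. intros n Hn. rewrite (Hsum n).
change (Cmod (C_sum (fun k => z ^ k * cmean (g k))%C n -
  (C_sum (fun k => z ^ k * cmean (g k))%C n + z ^ S n * cmean (fun t => (g (S n) t * kernel t)%C)))%C < eps).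
match goal with |- Cmod (?a - (?a + ?b))%C < _ => replace (a - (a + b))%C with (- b)%C by ring end.
rewrite Cmod_opp, Cmod_mult, Cmod_pow.
assert (Hb : Cmod (cmean (fun t => (g (S n) t * kernel t)%C)) <= K * (/ r) ^ S n).
{ replace (K * (/ r) ^ S n) with (2 * (B * (/ r) ^ S n * (r / (r - Cmod z)))) by (unfold K; ring).
  apply cmean_bound. apply Cgk. intros t Ht. unfold g. rewrite !Cmod_mult, Cmod_pow, Cmod_inv, Cmod_circ by (lra || apply circ_ne_0).
  apply Rmult_le_compat. apply Rmult_le_pos. apply Cmod_ge_0. apply pow_le. left; now apply Rinv_0_lt_compat.
  apply Cmod_ge_0. apply Rmult_le_compat_r. apply pow_le. left; now apply Rinv_0_lt_compat. now apply HB. apply Cmod_kernel. }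
apply Rle_lt_trans with (K * q ^ S n).
{ unfold q, Rdiv. rewrite Rpow_mult_distr. 
  replace (K * (Cmod z ^ S n * (/ r) ^ S n)) with (Cmod z ^ S n * (K * (/ r) ^ S n)) by ring.
  apply Rmult_le_compat_l. apply pow_le, Cmod_ge_0. exact Hb. }
specialize (HN (S n) ltac:(lia)). rewrite Rabs_pos_eq in HN by (apply pow_le; lra).
apply Rle_lt_trans with ((K + 1) * q ^ S n).
apply Rmult_le_compat_r. apply pow_le; lra. lra.
apply Rmult_lt_reg_r with (/ (K + 1)). apply Rinv_0_lt_compat; lra.
replace ((K + 1) * q ^ S n * / (K + 1)) with (q ^ S n) by (field; lra). exact HN.
Qed.

(** The expansion for h = 1 has only its constant term, since the mean of w^(-n) vanishes for n > 0;
    uniqueness of the sum gives the value. *)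
Lemma cmean_kernel : cmean kernel = RtoC 1.
Proof.
assert (H := cmean_kernel_pseries (fun _ => RtoC 1) 1 (fun t => C_continuous_const _ t)
  (fun t _ => Req_le _ _ Cmod_1)).
apply (proj1 (C_pseries_series _ _ _)) in H.
rewrite (cmean_ext _ kernel) in H by (intros; ring).
apply (C_series_unique _ _ _ H).
apply is_series_C_eps. intros eps He. exists 0%nat. intros n _.
replace (C_sum (fun k : nat => z ^ k * cmean (fun t : R => 1 * (/ circ r t) ^ k))%C n) with (RtoC 1).
replace (1 - 1)%C with (RtoC 0) by ring. now rewrite Cmod_0.
induction n as [|n IH].
- rewrite C_sum_0. rewrite (cmean_ext _ (fun _ => RtoC 1)) by (intros; simpl; ring).
  rewrite cmean_const. simpl; ring.
- rewrite C_sum_S, <- IH. rewrite (cmean_ext _ (fun t => (/ circ r t) ^ S n)%C) by (intros; ring).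
  rewrite cmean_inv_circ_pow by (auto using radius_pos with arith). ring.
Qed.

End Kernel.

(* The circle is contracted to [z] along [p s t = z + s (circ r t - z)]: the
   derivative in [s] of the integrand is the derivative in [t] of
   [- i f (p s t) / s] (of [- i f'(z) circ r t] at [s = 0]), which is periodic. *)
Lemma cauchy_formula (f f' : C -> C) (R0 r : R) (z : C) :
  (forall w, Cmod w < R0 -> C_is_derive f w (f' w)) ->
  (forall w, Cmod w < R0 -> C_continuous_eps f' w) ->
  Cmod z < r -> r < R0 ->
  cmean (fun t => (f (circ r t) * kernel r z t)%C) = f z.
Proof.
intros Hf Hf' Hz Hr. assert (Hr0 := radius_pos r z Hz).
(* This choice makes (1 + 2 eta) r the midpoint of r and R0, so the contracted circles stay in the
   disk of radius R0 even for s slightly outside [0, 1]. *)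
set (eta := (R0 / r - 1) / 4).
assert (Heta : 0 < eta).
{ unfold eta. assert (1 < R0 / r); [|lra].
  apply Rmult_lt_reg_r with r. auto. unfold Rdiv. rewrite Rmult_assoc, Rinv_l; lra. }
set (p := fun (s : R) (t : R) => (z + s * (circ r t - z))%C).
assert (Hp : forall s t, - eta < s < 1 + eta -> Cmod (p s t) < R0).
{ intros s t Hs. unfold p.
  replace (z + s * (circ r t - z))%C with (RtoC (1 - s) * z + s * circ r t)%C by (rewrite RtoC_minus; ring).
  eapply Rle_lt_trans. apply Cmod_triangle. rewrite !Cmod_mult, !Cmod_R, Cmod_circ by lra.
  apply Rle_lt_trans with ((1 + 2 * eta) * r).
  - assert (Rabs (1 - s) * Cmod z <= Rabs (1 - s) * r).
    { apply Rmult_le_compat_l. apply Rabs_pos. lra. }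
    assert (Rabs (1 - s) + Rabs s <= 1 + 2 * eta).
    { unfold Rabs; destruct (Rcase_abs (1 - s)); destruct (Rcase_abs s); lra. }
    nra.
  - unfold eta. replace ((1 + 2 * ((R0 / r - 1) / 4)) * r) with ((r + R0) / 2) by (field; lra). lra. }
set (U := fun (s t : R) => (kernel r z t * f (p s t))%C).
set (dU := fun (s t : R) => (f' (p s t) * circ r t)%C).
set (V := fun (s t : R) => if Req_EM_T s 0 then (- Ci * f' z * circ r t)%C
   else (- Ci * RtoC (/ s) * f (p s t))%C).
assert (HU : forall s t, - eta < s < 1 + eta -> path_derive (fun s => U s t) s (dU s t)).
{ intros s t Hs. unfold U, dU.
  replace (f' (p s t) * circ r t)%C with (kernel r z t * (f' (p s t) * (circ r t - z)))%C.
  2:{ unfold kernel. field. now apply circ_minus_ne_0. }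
  apply (path_derive_scal (kernel r z t) (fun s => f (p s t))).
  apply (path_derive_comp f (fun s => p s t)). apply Hf, Hp, Hs. apply path_derive_affine. }
assert (HV : forall s t, - eta < s < 1 + eta -> path_derive (V s) t (dU s t)).
{ intros s t Hs. unfold V, dU. destruct (Req_EM_T s 0) as [->|Hs0].
  - replace (f' (p 0 t) * circ r t)%C with (- Ci * f' z * (Ci * circ r t))%C.
    apply (path_derive_scal (- Ci * f' z) (circ r)). apply path_derive_circ.
    unfold p. replace (z + 0 * (circ r t - z))%C with z by ring.
    replace (- Ci * f' z * (Ci * circ r t))%C with (- (Ci * Ci) * (f' z * circ r t))%C by ring.
    replace (- (Ci * Ci))%C with (RtoC 1). ring. apply injective_projections; unfold Ci; simpl; ring.
  - replace (f' (p s t) * circ r t)%C with (- Ci * RtoC (/ s) * (f' (p s t) * (s * (Ci * circ r t))))%C.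
    2:{ replace (- Ci * RtoC (/ s) * (f' (p s t) * (s * (Ci * circ r t))))%C
          with (- (Ci * Ci) * (RtoC (/ s) * s) * (f' (p s t) * circ r t))%C by ring.
        rewrite <- RtoC_mult, Rinv_l by auto.
        replace (- (Ci * Ci))%C with (RtoC 1). ring. apply injective_projections; unfold Ci; simpl; ring. }
    apply (path_derive_scal (- Ci * RtoC (/ s)) (fun t => f (p s t))).
    apply (path_derive_comp f (fun t => p s t)). apply Hf, Hp, Hs.
    assert (H := path_derive_plus_const (z - s * z) _ t _ (path_derive_scal s (circ r) t _ (path_derive_circ r t))).
    destruct H as [H1 H2]. split.
    + eapply is_derive_ext; [|exact H1]. intros u. unfold p. cbv beta. f_equal. ring.
    + eapply is_derive_ext; [|exact H2]. intros u. unfold p. cbv beta. f_equal. ring. }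
assert (HdU : forall s t, - eta < s < 1 + eta -> C_continuous (fun q : R * R => dU (fst q) (snd q)) (s, t)).
{ intros s t Hs. unfold dU.
  assert (Hc : C_continuous (fun q : R * R => circ r (snd q)) (s, t)).
  { destruct (C_continuous_circ r t) as [H1 H2]. split.
    - apply (continuous_comp (fun q : R * R => snd q) (fun u => Re (circ r u))). apply continuous_snd. exact H1.
    - apply (continuous_comp (fun q : R * R => snd q) (fun u => Im (circ r u))). apply continuous_snd. exact H2. }
  apply (C_continuous_mult (fun q : R * R => f' (p (fst q) (snd q))) (fun q => circ r (snd q))); [|exact Hc].
  apply (C_continuous_comp f' (fun q : R * R => p (fst q) (snd q))).
  2: now apply Hf', Hp.
  unfold p. apply (C_continuous_plus (fun _ => z)). apply C_continuous_const.
  apply (C_continuous_mult (fun q : R * R => RtoC (fst q)) (fun q => circ r (snd q) - z)%C).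
  - split; simpl. apply continuous_fst. apply continuous_const.
  - apply (C_continuous_plus (fun q : R * R => circ r (snd q)) (fun _ => - z)%C). exact Hc. apply C_continuous_const. }
assert (HUc : forall s t, - eta < s < 1 + eta -> C_continuous (U s) t).
{ intros s t Hs. unfold U.
  apply (C_continuous_mult (kernel r z) (fun t => f (p s t))). now apply kernel_continuous.
  apply (C_continuous_comp f (fun t => p s t)).
  2: eapply C_derive_continuous_eps, Hf, Hp, Hs.
  unfold p. apply (C_continuous_plus (fun _ => z)). apply C_continuous_const.
  apply (C_continuous_mult (fun _ => RtoC s) (fun t => circ r t - z)%C). apply C_continuous_const.
  apply (C_continuous_plus (circ r) (fun _ => - z)%C). apply C_continuous_circ. apply C_continuous_const. }
assert (HVp : forall s, V s 0 = V s (2 * PI)).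
{ intros s. unfold V, p. now rewrite <- circ_period. }
assert (H01 : cmean (U 0) = cmean (U 1)).
{ unfold cmean. f_equal; f_equal.
  - apply (RInt_homotopy (fun s t => Re (U s t)) (fun s t => Re (dU s t)) (fun s t => Re (V s t)) 0 (2 * PI) eta);
      auto using Rlt_le, two_PI_pos.
    + intros s t Hs. apply (HU s t Hs).
    + intros s t Hs. apply (HV s t Hs).
    + intros s t Hs. apply (HdU s t Hs).
    + intros s t Hs. apply (HUc s t Hs).
    + intros s. now rewrite HVp.
  - apply (RInt_homotopy (fun s t => Im (U s t)) (fun s t => Im (dU s t)) (fun s t => Im (V s t)) 0 (2 * PI) eta);
      auto using Rlt_le, two_PI_pos.
    + intros s t Hs. apply (HU s t Hs).
    + intros s t Hs. apply (HV s t Hs).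
    + intros s t Hs. apply (HdU s t Hs).
    + intros s t Hs. apply (HUc s t Hs).
    + intros s. now rewrite HVp. }
rewrite (cmean_ext _ (U 1)).
2:{ intros t. unfold U, p. replace (z + 1 * (circ r t - z))%C with (circ r t) by ring. ring. }
rewrite <- H01. rewrite (cmean_ext _ (fun t => f z * kernel r z t)%C).
2:{ intros t. unfold U, p. replace (z + 0 * (circ r t - z))%C with z by ring. ring. }
rewrite cmean_scal by (intros; now apply kernel_continuous).
rewrite cmean_kernel by exact Hz. ring.
Qed.

Lemma C_pseries_re (a : nat -> C) (x : R) (l : C) :
  C_pseries a (RtoC x) l -> is_pseries (fun n => Re (a n)) x (Re l) /\ is_pseries (fun n => Im (a n)) x (Im l).
Proof.
intros H. apply (proj1 (C_pseries_series _ _ _)) in H. apply C_series_re_im in H. destruct H as [H1 H2].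
split; apply (proj2 (is_pseries_R _ _ _)).
- eapply is_series_ext; [|exact H1]. intros n. cbv beta. rewrite <- RtoC_pow, re_scal_l. apply Rmult_comm.
- eapply is_series_ext; [|exact H2]. intros n. cbv beta. rewrite <- RtoC_pow, im_scal_l. apply Rmult_comm.
Qed.

Lemma CV_radius_ge_R (a : nat -> R) (R0 : R) :
  0 < R0 -> (forall x, 0 <= x < R0 -> ex_pseries a x) -> Rbar_le R0 (CV_radius a).
Proof.
intros HR H. apply Rbar_not_lt_le. intros Hlt.
assert (Hge := CV_radius_ge_0 a).
destruct (CV_radius a) as [c| |] eqn:Ec; simpl in *; try tauto.
assert (Hx : 0 <= (c + R0) / 2 < R0) by lra.
specialize (H _ Hx). apply (proj1 (ex_pseries_R _ _)) in H. apply ex_series_lim_0 in H.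
apply (CV_disk_outside a ((c + R0) / 2)); [|exact H].
rewrite Ec. simpl. rewrite Rabs_pos_eq; lra.
Qed.

(** On the real axis the real and imaginary parts of the coefficients form real power series with
    equal sums, and uniqueness for real power series applies to each. *)
Lemma C_pseries_coef_unique (a b : nat -> C) (f : C -> C) (R0 : R) :
  0 < R0 -> (forall z, Cmod z < R0 -> C_pseries a z (f z)) ->
  (forall z, Cmod z < R0 -> C_pseries b z (f z)) -> forall n, a n = b n.
Proof.
intros HR Ha Hb n.
assert (K : forall u v : nat -> R, (forall x, Rabs x < R0 -> ex_pseries u x /\ PSeries u x = PSeries v x /\ ex_pseries v x) ->
   u n = v n).
{ intros u v H.
  assert (Hc : forall w, (forall x, Rabs x < R0 -> ex_pseries w x) -> Rbar_lt 0 (CV_radius w)).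
  { intros w Hw. apply Rbar_lt_le_trans with R0. exact HR. apply CV_radius_ge_R. exact HR.
    intros x Hx. apply Hw. rewrite Rabs_pos_eq; lra. }
  apply (PSeries_ext_recip u v n (Hc u (fun x Hx => proj1 (H x Hx)))
    (Hc v (fun x Hx => proj2 (proj2 (H x Hx))))).
  exists (mkposreal R0 HR). intros y Hy. apply H.
  change (Rabs (y - 0) < R0) in Hy. now rewrite Rminus_0_r in Hy. }
assert (L : forall x, Rabs x < R0 -> Cmod (RtoC x) < R0) by (intros; now rewrite Cmod_R).
apply injective_projections.
- apply (K (fun n => Re (a n)) (fun n => Re (b n))). intros x Hx.
  destruct (C_pseries_re _ _ _ (Ha _ (L x Hx))) as [A1 _].
  destruct (C_pseries_re _ _ _ (Hb _ (L x Hx))) as [B1 _].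
  repeat split; try (eexists; eassumption).
  now rewrite (is_pseries_unique _ _ _ A1), (is_pseries_unique _ _ _ B1).
- apply (K (fun n => Im (a n)) (fun n => Im (b n))). intros x Hx.
  destruct (C_pseries_re _ _ _ (Ha _ (L x Hx))) as [_ A1].
  destruct (C_pseries_re _ _ _ (Hb _ (L x Hx))) as [_ B1].
  repeat split; try (eexists; eassumption).
  now rewrite (is_pseries_unique _ _ _ A1), (is_pseries_unique _ _ _ B1).
Qed.

Lemma circle_bounded (f f' : C -> C) (R0 r : R) :
  (forall w, Cmod w < R0 -> C_is_derive f w (f' w)) -> 0 < r < R0 ->
  exists B, forall t, 0 <= t <= 2 * PI -> Cmod (f (circ r t)) <= B.
Proof.
intros Hf Hr.
assert (Hc : forall t, C_continuous (fun t => f (circ r t)) t).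
{ intros t. apply (C_continuous_comp f (circ r)). apply C_continuous_circ.
  eapply C_derive_continuous_eps, Hf. rewrite Cmod_circ; lra. }
assert (K : forall u : R -> R, (forall t, continuous u t) -> exists B, forall t, 0 <= t <= 2 * PI -> Rabs (u t) <= B).
{ intros u Hu.
  assert (Hu' : forall c, 0 <= c <= 2 * PI -> continuity_pt (fun t => Rabs (u t)) c).
  { intros c _. apply continuity_pt_filterlim.
    apply (continuous_comp u Rabs c). apply Hu. apply continuous_Rabs. }
  destruct (continuity_ab_maj (fun t => Rabs (u t)) 0 (2 * PI) (Rlt_le _ _ two_PI_pos) Hu') as [m [Hm _]].
  exists (Rabs (u m)). exact Hm. }
destruct (K _ (fun t => proj1 (Hc t))) as [B1 HB1].
destruct (K _ (fun t => proj2 (Hc t))) as [B2 HB2].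
exists (B1 + B2). intros t Ht.
eapply Rle_trans. apply Cmod_le_re_im. apply Rplus_le_compat; auto.
Qed.

(** Cauchy's formula on each circle of radius r < R0 gives an expansion inside it. By uniqueness its
    coefficients do not depend on r, so those of radius R0 / 2 serve on the whole disk. *)
Lemma taylor_disk (f f' : C -> C) (R0 : R) :
  0 < R0 ->
  (forall w, Cmod w < R0 -> C_is_derive f w (f' w)) ->
  (forall w, Cmod w < R0 -> C_continuous_eps f' w) ->
  exists c : nat -> C, forall z, Cmod z < R0 -> C_pseries c z (f z).
Proof.
intros HR Hf Hf'.
set (coef := fun r n => cmean (fun t => (f (circ r t) * (/ circ r t) ^ n)%C)).
assert (H : forall r, 0 < r < R0 -> forall z, Cmod z < r -> C_pseries (coef r) z (f z)).
{ intros r Hr z Hz.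
  destruct (circle_bounded f f' R0 r Hf Hr) as [B HB].
  assert (E := cauchy_formula f f' R0 r z Hf Hf' Hz (proj2 Hr)). cbv beta in E.
  assert (P : C_pseries (coef r) z (cmean (fun t => (f (circ r t) * kernel r z t)%C))).
  { refine (cmean_kernel_pseries r z Hz (fun t => f (circ r t)) B _ HB).
  intros t. apply (C_continuous_comp f (circ r)). apply C_continuous_circ.
  eapply C_derive_continuous_eps, Hf. rewrite Cmod_circ; lra. }
  rewrite E in P. exact P. }
exists (coef (R0 / 2)). intros z Hz.
(* A radius below R0 which exceeds |z| and is at least R0 / 2, so that both expansions hold on the
   disk of radius R0 / 2. *)
set (r := Rmax (R0 / 2) ((Cmod z + R0) / 2)).
assert (Hr1 : R0 / 2 <= r) by apply Rmax_l.
assert (Hr2 : (Cmod z + R0) / 2 <= r) by apply Rmax_r.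
assert (Hr3 : r < R0). { unfold r. apply Rmax_lub_lt; lra. }
assert (Hu : forall n, coef (R0 / 2) n = coef r n).
{ apply (C_pseries_coef_unique _ _ f (R0 / 2)). lra.
  - intros w Hw. apply H; lra.
  - intros w Hw. apply H; lra. }
apply (proj2 (C_pseries_series _ _ _)).
assert (Hs := proj1 (C_pseries_series _ _ _) (H r ltac:(lra) z ltac:(lra))).
eapply is_series_ext; [|exact Hs]. intros n. cbv beta. now rewrite Hu.
Qed.

Lemma C_is_derive_shift (f : C -> C) (z0 h l : C) :
  C_is_derive (fun w => f (z0 + w)%C) h l <-> C_is_derive f (z0 + h)%C l.
Proof.
rewrite !is_derive_C_eps.
split; intros H eps He; destruct (H eps He) as [d [Hd H']]; exists d; split; auto;
  intros k Hk; specialize (H' k Hk).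
- now rewrite <- Cplus_assoc.
- now rewrite Cplus_assoc.
Qed.

Lemma C_pseries_C_derive (a : nat -> C) (R0 : R) (f : C -> C) :
  (forall z, Cmod z < R0 -> C_pseries a z (f z)) ->
  forall z, Cmod z < R0 ->
    C_is_derive f z (C_derive f z) /\ C_pseries (C_PS_derive a) z (C_derive f z).
Proof.
intros H z Hz. destruct (C_pseries_derive a R0 f z H Hz) as [l [H1 H2]].
now rewrite (is_C_derive_unique _ _ _ H2).
Qed.

Lemma C_pseries_C_derive_continuous (a : nat -> C) (R0 : R) (f : C -> C) :
  (forall z, Cmod z < R0 -> C_pseries a z (f z)) ->
  forall z, Cmod z < R0 -> C_continuous_eps (C_derive f) z.
Proof.
intros H z Hz. apply C_derive_continuous_eps with (C_derive (C_derive f) z).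
apply (C_pseries_C_derive (C_PS_derive a) R0); auto.
intros w Hw. now apply (C_pseries_C_derive a R0).
Qed.

Lemma C_derive_shift (f : C -> C) (z0 h l : C) :
  C_is_derive f (z0 + h)%C l -> C_derive (fun w => f (z0 + w)%C) h = C_derive f (z0 + h)%C.
Proof.
intros H. rewrite (is_C_derive_unique _ _ _ H).
now apply is_C_derive_unique, C_is_derive_shift.
Qed.

Lemma analytic_on_disk_C_derive (f : C -> C) :
  analytic_on_disk f ->
  forall z, Cmod z < 1 -> C_is_derive f z (C_derive f z) /\ C_continuous_eps (C_derive f) z.
Proof.
intros Hf z Hz. destruct (Hf z Hz) as [c [r [Hr H]]].
assert (H' : forall h, Cmod h < r -> C_pseries c h (f (z + h)%C)).
{ intros h Hh. assert (E : (z + h - z)%C = h) by ring.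
  specialize (H (z + h)%C). rewrite E in H. now apply H. }
assert (D : forall h, Cmod h < r -> C_is_derive f (z + h)%C (C_derive f (z + h)%C)).
{ intros h Hh. destruct (C_pseries_C_derive c r _ H' h Hh) as [D _].
  apply (proj1 (C_is_derive_shift f z h _)) in D. now rewrite (is_C_derive_unique _ _ _ D). }
assert (Hz0 : (z + 0)%C = z) by ring.
assert (H0 : Cmod 0 < r) by (now rewrite Cmod_0).
split.
- specialize (D (RtoC 0) H0). now rewrite Hz0 in D.
- intros eps He.
  destruct (C_pseries_C_derive_continuous c r _ H' (RtoC 0) H0 eps He) as [d [Hd Hc]].
  exists (Rmin d r). split. now apply Rmin_pos.
  intros w Hw. specialize (Hc (w - z)%C).
  assert (E : (w - z - 0)%C = (w - z)%C) by ring. rewrite E in Hc. clear E.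
  assert (Hw1 := Rlt_le_trans _ _ _ Hw (Rmin_l _ _)).
  assert (Hw2 := Rlt_le_trans _ _ _ Hw (Rmin_r _ _)).
  specialize (Hc Hw1).
  rewrite (C_derive_shift f z (w - z)%C _ (D _ Hw2)) in Hc.
  rewrite (C_derive_shift f z 0 _ (D _ H0)) in Hc.
  now rewrite Cplus_minus, Hz0 in Hc.
Qed.

Lemma analytic_on_disk_pseries (f : C -> C) :
  analytic_on_disk f -> exists a, power_series_on_disk a f.
Proof.
intros Hf.
apply (taylor_disk f (C_derive f) 1 Rlt_0_1); intros w Hw; now apply analytic_on_disk_C_derive.
Qed.

(** Recentring at z0 is obtained from [taylor_disk] applied to the translate of f, in place of
    rearranging a double series. *)
Lemma pseries_analytic_on_disk (a : nat -> C) (f : C -> C) :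
  power_series_on_disk a f -> analytic_on_disk f.
Proof.
intros Hf z0 Hz0. unfold unit_disk in Hz0.
assert (Hin : forall h, Cmod h < 1 - Cmod z0 -> Cmod (z0 + h)%C < 1).
{ intros h Hh. eapply Rle_lt_trans. apply Cmod_triangle. lra. }
destruct (taylor_disk (fun h => f (z0 + h)%C) (fun h => C_derive f (z0 + h)%C) (1 - Cmod z0)) as [c Hc].
- lra.
- intros w Hw. apply C_is_derive_shift. now apply (C_pseries_C_derive a 1), Hin.
- intros w Hw eps He.
  destruct (C_pseries_C_derive_continuous a 1 f Hf _ (Hin w Hw) eps He) as [d [Hd Hc]].
  exists d. split. exact Hd. intros v Hv. apply Hc.
  now replace (z0 + v - (z0 + w))%C with (v - w)%C by ring.
- exists c, (1 - Cmod z0). split. lra.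
  intros z Hz. specialize (Hc (z - z0)%C Hz). now rewrite Cplus_minus in Hc.
Qed.

(** * Growth of the partial sums of the coefficients *)

Lemma R_sum_S_l (u : nat -> R) (n : nat) :
  sum_n u (S n) = u 0%nat + sum_n (fun k => u (S k)) n :> R.
Proof.
induction n as [|n IH].
- now rewrite R_sum_S, !R_sum_0.
- rewrite R_sum_S, IH, (R_sum_S (fun k => u (S k))). ring.
Qed.

Lemma R_sum_rev (u : nat -> R) (n : nat) : sum_n (fun k => u (n - k)%nat) n = sum_n u n :> R.
Proof.
induction n as [|n IH].
- now rewrite !R_sum_0.
- rewrite R_sum_S_l, R_sum_S. simpl (S n - 0)%nat.
  rewrite (sum_n_ext _ (fun k => u (n - k)%nat)) by (intros; reflexivity). rewrite IH. apply Rplus_comm.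
Qed.

Lemma R_sum_le (u v : nat -> R) (n : nat) :
  (forall k, (k <= n)%nat -> u k <= v k) -> sum_n u n <= sum_n v n.
Proof.
induction n as [|n IH]; intros H.
- rewrite !R_sum_0. now apply H.
- rewrite !R_sum_S. apply Rplus_le_compat. apply IH. intros; apply H; lia. apply H; lia.
Qed.

Lemma R_sum_scal (c : R) (u : nat -> R) (n : nat) : sum_n (fun k => c * u k) n = c * sum_n u n :> R.
Proof.
induction n as [|n IH]. now rewrite !R_sum_0. rewrite !R_sum_S, IH. ring.
Qed.

Lemma R_sum_plus (u v : nat -> R) (n : nat) : sum_n (fun k => u k + v k) n = sum_n u n + sum_n v n :> R.
Proof.
induction n as [|n IH]. now rewrite !R_sum_0. rewrite !R_sum_S, IH. ring.
Qed.

Lemma C_sum_scal (c : C) (u : nat -> C) (n : nat) : C_sum (fun k => (c * u k)%C) n = (c * C_sum u n)%C :> C.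
Proof.
induction n as [|n IH]. now rewrite !C_sum_0. rewrite !C_sum_S, IH. ring.
Qed.

Lemma C_sum_ext (u v : nat -> C) (n : nat) :
  (forall k, (k <= n)%nat -> u k = v k) -> C_sum u n = C_sum v n :> C.
Proof. apply (sum_n_ext_loc (G := C_AbelianMonoid)). Qed.

(** A discrete form of the integral test: each term of a sum of powers is dominated by an increment
    of the primitive, and the increments telescope. *)
Lemma Rpower_increment (d x : R) : 0 < x ->
  exists c, x < c < x + 1 /\ Rpower (x + 1) d - Rpower x d = d * Rpower c (d - 1).
Proof.
intros Hx.
destruct (MVT_cor2 (fun t => Rpower t d) (fun t => d * Rpower t (d - 1)) x (x + 1)) as [c [H1 H2]].
- lra.
- intros c Hc. apply derivable_pt_lim_power. lra.
- exists c. split. exact H2. rewrite H1. ring.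
Qed.

Lemma Rpower_le_neg (d x y : R) : d <= 0 -> 0 < x <= y -> Rpower y d <= Rpower x d.
Proof.
intros Hd Hxy. unfold Rpower.
assert (ln x <= ln y). { destruct (Req_dec x y) as [->|]. lra. left; apply ln_increasing; lra. }
destruct (Req_dec (d * ln y) (d * ln x)) as [->|]. lra.
left. apply exp_increasing. nra.
Qed.

Lemma Rpower_pos (x d : R) : 0 < Rpower x d.
Proof. apply exp_pos. Qed.

Lemma sum_Rpower_le (e : R) (n : nat) : 0 < e < 1 ->
  sum_n (fun j => Rpower (INR (S j)) (e - 1)) n <= Rpower (INR (S n)) e / e.
Proof.
intros He. induction n as [|n IH].
- rewrite R_sum_0. simpl. unfold Rpower. rewrite ln_1, !Rmult_0_r, exp_0.
  apply Rmult_le_reg_r with e. lra. unfold Rdiv. rewrite Rmult_assoc, Rinv_l; lra.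
- rewrite R_sum_S. rewrite (S_INR (S n)).
  assert (Hn : 0 < INR (S n)) by (apply lt_0_INR; lia).
  destruct (Rpower_increment e (INR (S n)) Hn) as [c [Hc1 Hc2]].
  assert (H := Rpower_le_neg (e - 1) c (INR (S n) + 1) ltac:(lra) ltac:(lra)).
  apply Rle_trans with (Rpower (INR (S n)) e / e + Rpower c (e - 1)). lra.
  right. replace (Rpower (INR (S n) + 1) e) with (Rpower (INR (S n)) e + e * Rpower c (e - 1)) by lra.
  field. lra.
Qed.

Lemma Cmod_one_minus_circ (t : R) : Cmod (1 - circ 1 t)%C = 2 * Rabs (sin (t / 2)).
Proof.
replace (2 * Rabs (sin (t / 2))) with (sqrt ((2 * sin (t / 2))²)).
2:{ rewrite sqrt_Rsqr_abs, Rabs_mult, (Rabs_pos_eq 2); lra. }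
unfold Cmod, circ. simpl. f_equal.
replace t with (2 * (t / 2)) at 1 2 3 4 by field.
set (x := t / 2). rewrite cos_2a_sin, sin_2a.
assert (S := sin2_cos2 x). unfold Rsqr in *. nra.
Qed.

(** Up to pi / 3 the derivative is at least 1 / 2; beyond, sin x >= sqrt 3 / 2 >= 0.85, while x / 3
    <= pi / 6 <= 2 / 3. The slope 1 / 3 suffices because pi >= 3 then gives sin (q pi) >= q for 0 <=
    q <= 1 / 2. *)
Lemma sin_ge_third (x : R) : 0 <= x <= PI / 2 -> x / 3 <= sin x.
Proof.
intros Hx. assert (HP := PI_RGT_0).
assert (H13 : forall y, 0 <= y <= PI / 3 -> y / 2 <= sin y).
{ intros y Hy. destruct (Req_dec y 0) as [->|Hy0]. rewrite sin_0; lra.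
  destruct (MVT_cor2 sin cos 0 y) as [c [H1 H2]]. lra.
  intros; apply derivable_pt_lim_sin.
  rewrite sin_0 in H1.
  assert (1 / 2 <= cos c). { rewrite <- cos_PI3. apply cos_decr_1; lra. }
  nra. }
destruct (Rle_dec x (PI / 3)) as [H|H]. specialize (H13 x); lra.
assert (sin (PI / 3) <= sin x) by (apply sin_incr_1; lra).
rewrite sin_PI3 in H0. assert (HP4 := PI_4).
assert (1.7 <= sqrt 3).
{ rewrite <- (sqrt_Rsqr 1.7) by lra. apply sqrt_le_1; unfold Rsqr; lra. }
generalize PI_4. lra.
Qed.

Lemma circ1_pow (t : R) (k : nat) : (circ 1 t ^ k)%C = circ 1 (INR k * t) :> C.
Proof.
induction k as [|k IH].
- simpl. unfold circ. rewrite Rmult_0_l, cos_0, sin_0. apply injective_projections; simpl; ring.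
- rewrite Cpow_S, IH, circ_mult, S_INR. f_equal; ring.
Qed.

Lemma circ1_2PI (k : nat) : circ 1 (2 * PI * INR k) = RtoC 1.
Proof.
unfold circ. replace (2 * PI * INR k) with (0 + 2 * INR k * PI) by ring.
rewrite sin_period, cos_period, sin_0, cos_0. apply injective_projections; simpl; ring.
Qed.

Lemma C_geom_sum (z : C) (N : nat) :
  ((1 - z) * C_sum (fun k => z ^ k)%C N)%C = (1 - z ^ S N)%C :> C.
Proof.
induction N as [|N IH]. rewrite C_sum_0. simpl. ring.
rewrite C_sum_S, Cmult_plus_distr_l, IH, (Cpow_S z (S N)). ring.
Qed.

Lemma circ1_minus_ne (t : R) : sin (t / 2) <> 0 -> (1 - circ 1 t)%C <> RtoC 0.
Proof.
intros H. apply Cmod_gt_0. rewrite Cmod_one_minus_circ. assert (P := Rabs_pos_lt _ H). lra.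
Qed.

Lemma Rle_interpolate (x a b e : R) : 0 < e < 1 -> 0 < x -> x <= a -> x <= b ->
  x <= Rpower a e * Rpower b (1 - e).
Proof.
intros He Hx Ha Hb.
replace x with (Rpower x e * Rpower x (1 - e)).
2:{ rewrite <- Rpower_plus. replace (e + (1 - e)) with 1 by ring. now apply Rpower_1. }
apply Rmult_le_compat; try (left; apply Rpower_pos); apply Rle_Rpower_l; lra.
Qed.

Lemma C_sum_switch (u : nat -> nat -> C) (p q : nat) :
  C_sum (fun i => C_sum (u i) q) p = C_sum (fun j => C_sum (fun i => u i j) p) q :> C.
Proof. apply (sum_n_switch (G := C_AbelianMonoid)). Qed.

(** * Sampling at roots of unity and the Dirichlet kernel *)

Section RootsOfUnity.

Context (n : nat).

Definition root_angle (j : nat) : R := 2 * PI * INR j / INR (S n).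

Lemma INR_S_pos : 0 < INR (S n).
Proof. apply lt_0_INR. lia. Qed.

(** The sum is geometric with ratio z satisfying z^(n + 1) = 1. For k <> m both at most n, the half
    angle of z is q pi with 0 < |q| < 1, hence z <> 1 and the sum vanishes. Sampling is therefore
    exact for these degrees. *)
Lemma roots_orthogonal (k m : nat) : (k <= n)%nat -> (m <= n)%nat ->
  C_sum (fun j => (circ 1 (root_angle j) ^ k * circ 1 (- root_angle j) ^ m)%C) n =
  RtoC (if Nat.eq_dec k m then INR (S n) else 0) :> C.
Proof.
intros Hk Hm. assert (HL := INR_S_pos).
set (z := circ 1 ((INR k - INR m) * (2 * PI / INR (S n)))).
rewrite (C_sum_ext _ (fun j => (z ^ j)%C)).
2:{ intros j _. unfold z. rewrite !circ1_pow, circ_mult. unfold root_angle. f_equal. ring. field. lra. }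
destruct (Nat.eq_dec k m) as [->|Hne].
- replace z with (RtoC 1).
  2:{ unfold z. rewrite Rminus_diag, Rmult_0_l. unfold circ. rewrite cos_0, sin_0.
      apply injective_projections; simpl; ring. }
  clear. induction n as [|p IH]. rewrite C_sum_0. simpl. ring.
  rewrite C_sum_S, IH, Cpow_1_l, (S_INR (S p)), RtoC_plus. ring.
- assert (Hz : (1 - z)%C <> RtoC 0).
  { apply circ1_minus_ne.
    set (y := (INR k - INR m) * (2 * PI / INR (S n)) / 2).
    assert (Hy : y = (INR k - INR m) / INR (S n) * PI) by (unfold y; field; lra).
    assert (HP := PI_RGT_0).
    assert (Hk' : INR k < INR (S n)) by (apply lt_INR; lia).
    assert (Hm' : INR m < INR (S n)) by (apply lt_INR; lia).
    assert (Hk0 := pos_INR k). assert (Hm0 := pos_INR m).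
    set (q := (INR k - INR m) / INR (S n)) in *.
    assert (Hq : q * INR (S n) = INR k - INR m) by (unfold q; field; lra).
    destruct (Rtotal_order (INR k) (INR m)) as [H|[H|H]].
    - assert (- 1 < q < 0) by nra.
      assert (0 < sin (- y)) by (apply sin_gt_0; nra). rewrite sin_neg in H1. lra.
    - apply INR_eq in H. contradiction.
    - assert (0 < q < 1) by nra.
      assert (0 < sin y) by (apply sin_gt_0; nra). lra. }
  assert (Hp : (z ^ S n)%C = RtoC 1).
  { unfold z. rewrite circ1_pow.
    replace (INR (S n) * ((INR k - INR m) * (2 * PI / INR (S n)))) with (2 * PI * INR k + - (2 * PI * INR m)) by (field; lra).
    assert (E := circ_mult 1 1 (2 * PI * INR k) (- (2 * PI * INR m))).
    rewrite Rmult_1_r in E. rewrite <- E, circ1_2PI.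
    assert (E2 := circ_mult 1 1 (2 * PI * INR m) (- (2 * PI * INR m))).
    rewrite circ1_2PI, Rplus_opp_r, Rmult_1_r in E2.
    rewrite E2. unfold circ. rewrite cos_0, sin_0. apply injective_projections; simpl; ring. }
  assert (G := C_geom_sum z n). rewrite Hp in G.
  replace (C_sum (fun j => z ^ j)%C n) with (/ (1 - z) * ((1 - z) * C_sum (fun k => z ^ k)%C n))%C by (field; auto).
  rewrite G. ring.
Qed.

Definition dirichlet (M j : nat) : C := C_sum (fun m => (circ 1 (- root_angle j) ^ m)%C) M.

Lemma Cmod_dirichlet_le (M j : nat) : Cmod (dirichlet M j) <= INR (S M).
Proof.
unfold dirichlet. eapply Rle_trans. apply Cmod_C_sum_le with (b := fun _ => 1).
intros k _. rewrite Cmod_pow, Cmod_circ, pow1; lra.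
rewrite sum_n_const. lra.
Qed.

Lemma Cmod_dirichlet_le_sin (M j : nat) : 0 < sin (root_angle j / 2) ->
  Cmod (dirichlet M j) <= / sin (root_angle j / 2).
Proof.
intros Hs. unfold dirichlet.
assert (G := C_geom_sum (circ 1 (- root_angle j)) M).
apply (f_equal Cmod) in G. rewrite Cmod_mult, Cmod_one_minus_circ in G.
replace (- root_angle j / 2) with (- (root_angle j / 2)) in G by field.
rewrite sin_neg, Rabs_Ropp, (Rabs_pos_eq (sin _)) in G by lra.
assert (T : Cmod (1 - circ 1 (- root_angle j) ^ S M)%C <= 2).
{ eapply Rle_trans. apply Cmod_triangle. rewrite Cmod_opp, Cmod_pow, Cmod_circ, pow1, Cmod_1; lra. }
apply Rmult_le_reg_l with (sin (root_angle j / 2)). exact Hs. rewrite Rinv_r by lra. lra.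
Qed.

(** The kernel peaks at both ends of the range, as the angles 0 and 2 pi coincide; the second half
    follows from sin (pi - x) = sin x. Writing S j for j includes the peak j = 0, at the cost of the
    factor 2. *)
Lemma dirichlet_dichotomy (M j : nat) : (M <= n)%nat -> (j <= n)%nat ->
  Cmod (dirichlet M j) <= 2 * INR (S n) / INR (S j) \/
  Cmod (dirichlet M j) <= 2 * INR (S n) / INR (S (n - j)).
Proof.
intros HM Hj. assert (HL := INR_S_pos). assert (HP := PI_RGT_0).
assert (HP2 : 3 <= PI) by (generalize PI2_3_2; lra).
destruct (Nat.eq_dec j 0) as [->|Hj0].
{ left. eapply Rle_trans. apply Cmod_dirichlet_le. simpl (INR 1).
  assert (INR (S M) <= INR (S n)) by (apply le_INR; lia). lra. }
assert (Hj1 : 1 <= INR j). { change 1 with (INR 1). apply le_INR. lia. }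
assert (HjL : INR (S (n - j)) = INR (S n) - INR j). { rewrite <- minus_INR by lia. f_equal. lia. }
assert (Hjp : 1 <= INR (S (n - j))). { rewrite S_INR. generalize (pos_INR (n - j)); lra. }
assert (Hh : root_angle j / 2 = INR j / INR (S n) * PI) by (unfold root_angle; field; lra).
assert (K : forall x, 0 < x -> 2 * x <= INR (S n) -> sin (root_angle j / 2) = sin (x / INR (S n) * PI) ->
   Cmod (dirichlet M j) <= INR (S n) / x).
{ intros x Hx Hx2 E.
  assert (Hq : 0 < x / INR (S n)) by now apply Rdiv_lt_0_compat.
  assert (Hq2 : x / INR (S n) <= / 2).
  { apply Rmult_le_reg_r with (INR (S n)). exact HL. unfold Rdiv. rewrite Rmult_assoc, Rinv_l; lra. }
  assert (S1 := sin_ge_third (x / INR (S n) * PI) ltac:(nra)).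
  assert (S2 : x / INR (S n) <= sin (root_angle j / 2)) by (rewrite E; nra).
  eapply Rle_trans. apply Cmod_dirichlet_le_sin. lra.
  replace (INR (S n) / x) with (/ (x / INR (S n))) by (field; lra).
  apply Rinv_le_contravar; lra. }
destruct (Rle_dec (2 * INR j) (INR (S n))) as [Hc|Hc].
- left. eapply Rle_trans. apply (K (INR j)); try lra. now rewrite Hh.
  rewrite (S_INR j).
  replace (2 * INR (S n) / (INR j + 1)) with (INR (S n) / INR j * (2 * INR j / (INR j + 1))) by (field; lra).
  rewrite <- (Rmult_1_r (INR (S n) / INR j)) at 1. apply Rmult_le_compat_l.
  left; apply Rdiv_lt_0_compat; lra.
  apply Rmult_le_reg_r with (INR j + 1). lra. unfold Rdiv. rewrite Rmult_assoc, Rinv_l; lra.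
- right. eapply Rle_trans. apply (K (INR (S (n - j)))); try lra.
  + rewrite Hh, HjL. rewrite <- (sin_PI_x ((INR (S n) - INR j) / INR (S n) * PI)). f_equal. field. lra.
  + unfold Rdiv. rewrite Rmult_assoc. assert (0 < INR (S n) * / INR (S (n - j))). apply Rmult_lt_0_compat. lra. apply Rinv_0_lt_compat; lra. lra.
Qed.

(* Interpolating between the two bounds on the kernel, [a^e b^(1-e)], replaces
   the usual logarithm by a power [e] that can be taken small. *)
Lemma sum_dirichlet_le (M : nat) (e : R) : (M <= n)%nat -> 0 < e < 1 ->
  sum_n (fun j => Cmod (dirichlet M j)) n <= 4 / e * Rpower (INR (S M)) e * INR (S n).
Proof.
intros HM He. assert (HL := INR_S_pos).
set (w := fun j => Rpower (2 * INR (S n) / INR (S j)) (1 - e)).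
assert (Hterm : forall j, (j <= n)%nat -> Cmod (dirichlet M j) <= Rpower (INR (S M)) e * (w j + w (n - j)%nat)).
{ intros j Hj. unfold w.
  assert (P1 := Rpower_pos (2 * INR (S n) / INR (S j)) (1 - e)).
  assert (P2 := Rpower_pos (2 * INR (S n) / INR (S (n - j))) (1 - e)).
  assert (P0 := Rpower_pos (INR (S M)) e).
  destruct (Req_dec (Cmod (dirichlet M j)) 0) as [E|E].
  { rewrite E. nra. }
  assert (Hx : 0 < Cmod (dirichlet M j)) by (generalize (Cmod_ge_0 (dirichlet M j)); lra).
  destruct (dirichlet_dichotomy M j HM Hj) as [H|H].
  - generalize (Rle_interpolate _ _ _ e He Hx (Cmod_dirichlet_le M j) H). nra.
  - generalize (Rle_interpolate _ _ _ e He Hx (Cmod_dirichlet_le M j) H). nra. }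
eapply Rle_trans. apply R_sum_le, Hterm.
rewrite R_sum_scal, R_sum_plus, (R_sum_rev w).
assert (Hw : sum_n w n <= 2 * INR (S n) / e).
{ rewrite (sum_n_ext w (fun j => Rpower (2 * INR (S n)) (1 - e) * Rpower (INR (S j)) (e - 1))).
  2:{ intros j. unfold w, Rpower.
      rewrite ln_div by (try apply lt_0_INR; lia || lra). rewrite <- exp_plus. f_equal. ring. }
  rewrite R_sum_scal.
  apply Rle_trans with (Rpower (2 * INR (S n)) (1 - e) * (Rpower (2 * INR (S n)) e / e)).
  - apply Rmult_le_compat_l. left; apply Rpower_pos.
    eapply Rle_trans. apply sum_Rpower_le. exact He.
    apply Rmult_le_compat_r. left; apply Rinv_0_lt_compat; lra. apply Rle_Rpower_l; lra.
  - unfold Rdiv. rewrite <- Rmult_assoc, <- Rpower_plus.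
    replace (1 - e + e) with 1 by ring. rewrite Rpower_1 by lra. lra. }
replace (4 / e * Rpower (INR (S M)) e * INR (S n)) with (Rpower (INR (S M)) e * (2 * INR (S n) / e + 2 * INR (S n) / e)) by (field; lra).
apply Rmult_le_compat_l. left; apply Rpower_pos. lra.
Qed.

Lemma C_sum_indicator (a : nat -> C) (m N : nat) : (m <= N)%nat ->
  C_sum (fun k => (a k * RtoC (if Nat.eq_dec k m then INR (S n) else 0))%C) N = (a m * INR (S n))%C :> C.
Proof.
assert (Z : forall N, (N < m)%nat ->
  C_sum (fun k => (a k * RtoC (if Nat.eq_dec k m then INR (S n) else 0))%C) N = RtoC 0 :> C).
{ clear. induction N as [|N IH]; intros H.
  - rewrite C_sum_0. destruct (Nat.eq_dec 0 m). lia. ring.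
  - rewrite C_sum_S, IH by lia. destruct (Nat.eq_dec (S N) m). lia. ring. }
induction N as [|N IH]; intros H.
- rewrite C_sum_0. destruct (Nat.eq_dec 0 m). now subst. lia.
- rewrite C_sum_S. destruct (Nat.eq_dec (S N) m) as [<-|Hne].
  + rewrite Z by lia. ring.
  + rewrite IH by lia. ring.
Qed.

(** By orthogonality the partial sum up to M is the mean over the roots of the polynomial of degree
    N times the kernel. The supremum of the polynomial then multiplies the mean modulus of the
    kernel. *)
Lemma partial_sum_bound (a : nat -> C) (M N : nat) (K e : R) :
  (M <= N)%nat -> (N <= n)%nat -> 0 < e < 1 ->
  (forall t, Cmod (C_sum (fun k => a k * circ 1 t ^ k)%C N) <= K) ->
  Cmod (C_sum a M) <= K * (4 / e * Rpower (INR (S M)) e).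
Proof.
intros HM HN He HK. assert (HL := INR_S_pos).
assert (HK0 : 0 <= K) by (eapply Rle_trans; [apply Cmod_ge_0 | apply (HK 0)]).
assert (E : (INR (S n) * C_sum a M)%C =
  C_sum (fun j => (C_sum (fun k => a k * circ 1 (root_angle j) ^ k)%C N * dirichlet M j)%C) n).
{ symmetry. rewrite (C_sum_ext _ (fun j => C_sum (fun m => C_sum (fun k =>
      (a k * (circ 1 (root_angle j) ^ k * circ 1 (- root_angle j) ^ m))%C) N) M)).
  2:{ intros j _. unfold dirichlet. rewrite <- C_sum_scal. apply C_sum_ext. intros m _.
      rewrite Cmult_comm, <- C_sum_scal. apply C_sum_ext. intros k _. ring. }
  rewrite C_sum_switch.
  rewrite <- C_sum_scal. apply C_sum_ext. intros m Hm.
  rewrite C_sum_switch.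
  rewrite (C_sum_ext _ (fun k => (a k * RtoC (if Nat.eq_dec k m then INR (S n) else 0))%C)).
  2:{ intros k Hk. rewrite C_sum_scal, roots_orthogonal by lia. reflexivity. }
  rewrite C_sum_indicator by lia. ring. }
apply (f_equal Cmod) in E. rewrite Cmod_mult, Cmod_R, Rabs_pos_eq in E by lra.
apply Rmult_le_reg_l with (INR (S n)). exact HL. rewrite E.
eapply Rle_trans. apply Cmod_C_sum_le with (b := fun j => K * Cmod (dirichlet M j)).
- intros j _. rewrite Cmod_mult. apply Rmult_le_compat_r. apply Cmod_ge_0. apply HK.
- rewrite R_sum_scal.
  replace (INR (S n) * (K * (4 / e * Rpower (INR (S M)) e)))
    with (K * (4 / e * Rpower (INR (S M)) e * INR (S n))) by ring.
  apply Rmult_le_compat_l. exact HK0. apply sum_dirichlet_le. lia. exact He.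
Qed.

End RootsOfUnity.

(** * Growth of Bloch functions and of partial sums *)

(** Plays the part of integrating df <= dg: the mean value theorem for g - f asks only for
    derivatives. *)
Lemma increment_le (f g df dg : R -> R) (a b : R) : a <= b ->
  (forall x, a <= x <= b -> is_derive f x (df x)) ->
  (forall x, a <= x <= b -> is_derive g x (dg x)) ->
  (forall x, a <= x <= b -> df x <= dg x) ->
  f b - f a <= g b - g a.
Proof.
intros Hab Hf Hg Hle.
destruct (Req_dec a b) as [->|Hne]. lra.
destruct (MVT_cor2 (fun x => g x - f x) (fun x => dg x - df x) a b) as [c [H1 H2]]. lra.
- intros c Hc. apply is_derive_Reals. apply (is_derive_minus (V := R_NormedModule) g f).
  now apply Hg. now apply Hf.
- specialize (Hle c ltac:(lra)). nra.
Qed.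

(** Turns a bound on a modulus into a bound on a real part, to which real mean value and Abel
    arguments apply. The inequality |u| <= 1 accommodates the choice u = 0 when d = 0. *)
Lemma unit_multiplier (d : C) : exists u : C, Cmod u <= 1 /\ Re (u * d)%C = Cmod d.
Proof.
destruct (Req_dec (Cmod d) 0) as [H|H].
- exists (RtoC 0). rewrite Cmod_0. split. lra. rewrite H. replace (0 * d)%C with (RtoC 0) by ring. reflexivity.
- assert (Hp : 0 < Cmod d) by (generalize (Cmod_ge_0 d); lra).
  exists (RtoC (/ Cmod d) * Cconj d)%C. split.
  + rewrite Cmod_mult, Cmod_R, Cmod_conj, Rabs_pos_eq, Rinv_l by (try (left; apply Rinv_0_lt_compat); lra). lra.
  + rewrite <- Cmult_assoc, (Cmult_comm (Cconj d)), <- Cmod2_conj, re_scal_l, re_RtoC. field. lra.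
Qed.

Lemma is_derive_Rpower_affine (p x s : R) : 0 < 1 - s * x ->
  is_derive (fun s => Rpower (1 - s * x) p) s (- (p * x) * Rpower (1 - s * x) (p - 1)).
Proof.
intros H.
replace (- (p * x) * Rpower (1 - s * x) (p - 1)) with (- x * (p * Rpower (1 - s * x) (p - 1))) by ring.
apply (is_derive_comp (fun y => Rpower y p) (fun s => 1 - s * x)).
- apply is_derive_Reals, derivable_pt_lim_power, H.
- auto_derive. auto. ring.
Qed.

(** Along the segment s z, the function M / (alpha - 1) (1 - s |z|)^(1 - alpha) has derivative M |z|
    (1 - s |z|)^(-alpha), which is the bound available for the derivative of Re (u f (s z)). *)
Lemma bloch_growth (f : C -> C) (alpha M : R) :
  1 < alpha ->
  (forall w, Cmod w < 1 -> C_is_derive f w (C_derive f w)) ->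
  (forall w, Cmod w < 1 -> Cmod (C_derive f w) <= M * Rpower (1 - Cmod w) (- alpha)) ->
  forall z, Cmod z < 1 ->
  Cmod (f z) <= Cmod (f (RtoC 0)) + M / (alpha - 1) * (Rpower (1 - Cmod z) (1 - alpha) - 1).
Proof.
intros Ha Hf Hb z Hz.
destruct (unit_multiplier (f z - f (RtoC 0))) as [u [Hu1 Hu2]].
assert (Hz0 := Cmod_ge_0 z).
assert (Hin : forall s, 0 <= s <= 1 -> Cmod (0 + s * z)%C = s * Cmod z).
{ intros s Hs. rewrite Cplus_0_l, Cmod_mult, Cmod_R, Rabs_pos_eq; lra. }
assert (H := increment_le (fun s : R => Re (u * f (0 + s * z))%C)
  (fun s => M / (alpha - 1) * Rpower (1 - s * Cmod z) (1 - alpha))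
  (fun s : R => Re (u * (C_derive f (0 + s * z) * z))%C)
  (fun s => M / (alpha - 1) * (- ((1 - alpha) * Cmod z) * Rpower (1 - s * Cmod z) (1 - alpha - 1)))
  0 1 ltac:(lra)).
cbv beta in H.
replace (0 + 1 * z)%C with z in H by ring. replace (0 + 0 * z)%C with (RtoC 0) in H by ring.
assert (H' : Cmod (f z - f (RtoC 0))%C <= M / (alpha - 1) * (Rpower (1 - Cmod z) (1 - alpha) - 1)).
{ rewrite <- Hu2.
  replace (u * (f z - f (RtoC 0)))%C with (u * f z - u * f (RtoC 0))%C by ring.
  unfold Cminus. rewrite re_plus, re_opp.
  replace (M / (alpha - 1) * (Rpower (1 - Cmod z) (1 - alpha) - 1)) with
    (M / (alpha - 1) * Rpower (1 - 1 * Cmod z) (1 - alpha) - M / (alpha - 1) * Rpower (1 - 0 * Cmod z) (1 - alpha)).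
  2:{ rewrite Rmult_0_l, Rminus_0_r, Rmult_1_l. unfold Rpower at 2. rewrite ln_1, Rmult_0_r, exp_0. ring. }
  apply H.
  - intros s Hs.
    apply (path_derive_scal u (fun s : R => f (0 + s * z)%C)).
    apply (path_derive_comp f (fun s : R => (0 + s * z)%C)). apply Hf. rewrite Hin by lra. nra.
    apply path_derive_affine.
  - intros s Hs. apply is_derive_scal. apply is_derive_Rpower_affine. nra.
  - intros s Hs. eapply Rle_trans. apply Rle_abs. eapply Rle_trans. apply re_le_Cmod.
    rewrite !Cmod_mult. 
    assert (Hd := Hb (0 + s * z)%C). rewrite Hin in Hd by lra. specialize (Hd ltac:(nra)).
    replace (1 - alpha - 1) with (- alpha) by ring.
    replace (M / (alpha - 1) * (- ((1 - alpha) * Cmod z) * Rpower (1 - s * Cmod z) (- alpha)))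
      with (M * Rpower (1 - s * Cmod z) (- alpha) * Cmod z) by (field; lra).
    assert (0 <= Cmod (C_derive f (0 + s * z)%C) * Cmod z) by (apply Rmult_le_pos; apply Cmod_ge_0).
    assert (Hg0 := Cmod_ge_0 u).
    apply Rle_trans with (1 * (Cmod (C_derive f (0 + s * z)%C) * Cmod z)). now apply Rmult_le_compat_r.
    rewrite Rmult_1_l. now apply Rmult_le_compat_r. }
replace (f z) with (f (RtoC 0) + (f z - f (RtoC 0)))%C by ring.
eapply Rle_trans. apply Cmod_triangle. lra.
Qed.

(** The weighted sum differs from w_m times the plain sum by terms (w_(k+1) - w_k) S_k, whose moduli
    telescope to at most (w_m - w_0) B. Increasing weights are what is needed to undo a damping by
    rho^k. *)
Lemma abel_summation_bound (u : nat -> C) (w : nat -> R) (B : R) (M : nat) :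
  0 <= w 0%nat -> (forall k, w k <= w (S k)) ->
  (forall m, (m <= M)%nat -> Cmod (C_sum u m) <= B) ->
  Cmod (C_sum (fun k => (w k * u k)%C) M) <= 2 * w M * B.
Proof.
intros Hw0 Hw HB.
assert (HB0 : 0 <= B) by (eapply Rle_trans; [apply Cmod_ge_0 | apply (HB 0%nat); lia]).
assert (K : forall m, (m <= M)%nat ->
   w 0%nat <= w m /\ Cmod (C_sum (fun k => (w k * u k)%C) m - w m * C_sum u m)%C <= (w m - w 0%nat) * B).
{ induction m as [|m IH]; intros Hm.
  - split. lra. rewrite !C_sum_0. replace (w 0%nat * u 0%nat - w 0%nat * u 0%nat)%C with (RtoC 0) by ring. rewrite Cmod_0. lra.
  - destruct IH as [IH1 IH2]. lia. specialize (Hw m). split. lra.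
    rewrite !C_sum_S.
    match goal with |- Cmod ?x <= _ => replace x with
      ((C_sum (fun k => w k * u k)%C m - w m * C_sum u m) + RtoC (w m - w (S m)) * C_sum u m)%C
      by (rewrite RtoC_minus; ring) end.
    eapply Rle_trans. apply Cmod_triangle. rewrite Cmod_mult, Cmod_R, Rabs_left1 by lra.
    assert (Hs := HB m ltac:(lia)).
    assert ((w (S m) - w m) * Cmod (C_sum u m) <= (w (S m) - w m) * B) by (apply Rmult_le_compat_l; lra).
    replace (- (w m - w (S m))) with (w (S m) - w m) by ring. nra. }
destruct (K M (le_n M)) as [K1 K2].
replace (C_sum (fun k => (w k * u k)%C) M) with
  ((C_sum (fun k => w k * u k)%C M - w M * C_sum u M) + w M * C_sum u M)%C by ring.
eapply Rle_trans. apply Cmod_triangle. rewrite Cmod_mult, Cmod_R, Rabs_pos_eq by lra.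
assert (w M * Cmod (C_sum u M) <= w M * B) by (apply Rmult_le_compat_l; [lra|now apply HB]).
nra.
Qed.

Lemma C_sum_minus_le (a : nat -> C) (l : C) (b : nat -> R) (B : R) (N : nat) :
  C_series a l -> is_series b B -> (forall n, Cmod (a n) <= b n) ->
  Cmod (l - C_sum a N)%C <= B - sum_n b N.
Proof.
intros Ha Hb H.
assert (K : forall p, Cmod (C_sum a (N + p) - C_sum a N)%C <= sum_n b (N + p) - sum_n b N).
{ induction p as [|p IH].
  - rewrite Nat.add_0_r. replace (C_sum a N - C_sum a N)%C with (RtoC 0) by ring. rewrite Cmod_0. lra.
  - rewrite Nat.add_succ_r, C_sum_S, R_sum_S. specialize (H (S (N + p))).
    replace (C_sum a (N + p) + a (S (N + p)) - C_sum a N)%C with (C_sum a (N + p) - C_sum a N + a (S (N + p)))%C by ring.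
    eapply Rle_trans. apply Cmod_triangle. lra. }
assert (Hb0 : forall k, 0 <= b k) by (intros k; eapply Rle_trans; [apply Cmod_ge_0|apply H]).
apply le_epsilon. intros eps He.
destruct (proj1 (is_series_C_eps a l) Ha eps He) as [N1 HN1].
specialize (HN1 (N + N1)%nat ltac:(lia)). specialize (K N1).
assert (T := sum_n_le_series b B (N + N1) Hb0 Hb).
replace (l - C_sum a N)%C with (- (C_sum a (N + N1) - l) + (C_sum a (N + N1) - C_sum a N))%C by ring.
eapply Rle_trans. apply Cmod_triangle. rewrite Cmod_opp. lra.
Qed.

Lemma Rpower_ge_1 (x p : R) : 1 <= x -> 0 <= p -> 1 <= Rpower x p.
Proof.
intros Hx Hp. rewrite <- (Rpower_O x) by lra.
destruct (Req_dec x 1) as [->|]. unfold Rpower; rewrite ln_1, !Rmult_0_r; lra.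
apply Rle_Rpower; lra.
Qed.

Lemma bernoulli_ineq (a : R) (n : nat) : -1 <= a <= 0 -> 1 + INR n * a <= (1 + a) ^ n.
Proof.
intros Ha. induction n as [|n IH]. simpl. lra.
rewrite S_INR. simpl pow. assert (H := pos_INR n).
apply Rle_trans with ((1 + a) * (1 + INR n * a)). nra.
apply Rmult_le_compat_l; lra.
Qed.

Lemma partial_sums_growth (a : nat -> C) (f : C -> C) (K0 beta e : R) :
  power_series_on_disk a f -> 0 <= beta <= 1 -> 0 < e < 1 -> 0 <= K0 ->
  (forall z, Cmod z < 1 -> Cmod (f z) <= K0 * Rpower (1 - Cmod z) (- beta)) ->
  exists B, forall M, Cmod (C_sum a M) <= B * Rpower (INR (S M)) (beta + e).
Proof.
intros Ha Hbeta He HK0 Hf.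
(* The factor 4 / e comes from the Dirichlet kernel, a further 4 = 2 * 2 from Abel summation and
   rho^(-M) <= 2, and 2 K0 + 1 from K0 (2 x)^beta + 1 <= (2 K0 + 1) x^beta. *)
exists (16 / e * (2 * K0 + 1)). intros M.
set (x := INR (S M)).
assert (Hx : 1 <= x). { unfold x. rewrite S_INR. generalize (pos_INR M); lra. }
set (rho := 1 - / (2 * x)).
assert (Hix : 0 < / (2 * x) <= / 2).
{ split. apply Rinv_0_lt_compat; lra. apply Rinv_le_contravar; lra. }
assert (Hrho : / 2 <= rho < 1) by (unfold rho; lra).
assert (HCV : Rbar_lt (Rabs rho) (CV_radius (fun n => Cmod (a n)))).
{ apply Rbar_lt_le_trans with 1. rewrite Rabs_pos_eq by lra. apply Hrho.
  apply (CV_radius_ge a 1 f Rlt_0_1 Ha). }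
apply CV_disk_inside in HCV.
assert (Hs := Series_correct _ HCV).
set (b := fun n => Rabs (Cmod (a n) * rho ^ n)) in *.
(* [partial_sum_bound] concerns polynomials, so f is truncated at a degree N >= M with error at most
   1, uniformly on the circle of radius rho. This is the summand 1 in K. *)
assert (HN0 : exists N, (M <= N)%nat /\ Series b - sum_n b N <= 1).
{ destruct (proj1 (R_series_eps _ _) Hs 1 Rlt_0_1) as [N0 H0].
  exists (max M N0). split. lia. specialize (H0 (max M N0) ltac:(lia)).
  apply Rabs_def2 in H0. lra. }
destruct HN0 as [N [HMN HN]].
set (K := K0 * Rpower (2 * x) beta + 1).
assert (HT : forall t, Cmod (C_sum (fun k => (a k * RtoC (rho ^ k)) * circ 1 t ^ k)%C N) <= K).
{ intros t. set (z := (rho * circ 1 t)%C).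
  assert (Hz : Cmod z = rho) by (unfold z; rewrite Cmod_mult, Cmod_R, Cmod_circ, Rabs_pos_eq; lra).
  assert (Hz1 : Cmod z < 1) by lra.
  assert (Hser := proj1 (C_pseries_series _ _ _) (Ha z Hz1)).
  rewrite (C_sum_ext _ (fun k => z ^ k * a k)%C).
  2:{ intros k _. unfold z. rewrite Cpow_mult_l, RtoC_pow. ring. }
  assert (D := C_sum_minus_le _ _ b (Series b) N Hser Hs).
  assert (D1 : Cmod (f z - C_sum (fun k => z ^ k * a k) N)%C <= 1).
  { eapply Rle_trans. apply D. intros n. unfold b. rewrite Cmod_mult, Cmod_pow, Hz.
    eapply Rle_trans. 2: apply Rle_abs. lra. exact HN. }
  replace (C_sum (fun k => z ^ k * a k)%C N) with (f z + - (f z - C_sum (fun k => z ^ k * a k)%C N))%C by ring.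
  eapply Rle_trans. apply Cmod_triangle. rewrite Cmod_opp. unfold K.
  apply Rplus_le_compat; [|exact D1].
  eapply Rle_trans. apply Hf, Hz1. rewrite Hz. right. f_equal. unfold rho.
  replace (1 - (1 - / (2 * x))) with (/ (2 * x)) by ring.
  unfold Rpower. rewrite ln_Rinv by lra. f_equal. ring. }
assert (HK : 1 <= K). { unfold K. assert (T := Rpower_pos (2 * x) beta). nra. }
set (B := K * (4 / e * Rpower x e)).
assert (HB : forall m, (m <= M)%nat -> Cmod (C_sum (fun k => a k * RtoC (rho ^ k))%C m) <= B).
{ intros m Hm. eapply Rle_trans.
  - apply (partial_sum_bound N (fun k => a k * RtoC (rho ^ k))%C m N K e); auto. lia.
  - unfold B. apply Rmult_le_compat_l. lra. apply Rmult_le_compat_l.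
    left; apply Rdiv_lt_0_compat; lra. apply Rle_Rpower_l. lra.
    split. apply lt_0_INR; lia. unfold x. apply le_INR. lia. }
assert (Hir : 1 <= / rho). { rewrite <- Rinv_1. apply Rinv_le_contravar; lra. }
(* The bound so far concerns a_k rho^k; the increasing weights rho^(-k) restore a_k. *)
assert (A := abel_summation_bound (fun k => a k * RtoC (rho ^ k))%C (fun k => (/ rho) ^ k) B M
  ltac:(simpl; lra) ltac:(intros k; simpl; assert (T := pow_le (/ rho) k ltac:(lra)); nra) HB).
rewrite (C_sum_ext _ a) in A.
2:{ intros k _. cbv beta. replace (RtoC ((/ rho) ^ k) * (a k * RtoC (rho ^ k)))%C with (RtoC ((/ rho) ^ k) * RtoC (rho ^ k) * a k)%C by ring.
    rewrite <- RtoC_mult, <- Rpow_mult_distr, Rinv_l, pow1 by lra. ring. }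
(* Bernoulli's inequality gives rho^M >= 1 - M / (2 (M + 1)) >= 1 / 2: the circle is close enough to
   the boundary for the damping to cost only a constant. *)
assert (Hp : (/ rho) ^ M <= 2).
{ rewrite pow_inv. rewrite <- (Rinv_inv 2). apply Rinv_le_contravar. lra.
  assert (T := bernoulli_ineq (- / (2 * x)) M ltac:(lra)).
  replace (1 + - / (2 * x)) with rho in T by (unfold rho; ring).
  eapply Rle_trans; [|exact T].
  assert (INR M = x - 1) by (unfold x; rewrite S_INR; ring). rewrite H.
  replace (1 + (x - 1) * - / (2 * x)) with (1 - / 2 + / (2 * x)) by (field; lra). lra. }
assert (HB0 : 0 <= B).
{ unfold B. apply Rmult_le_pos. lra. apply Rmult_le_pos. left; apply Rdiv_lt_0_compat; lra. left; apply Rpower_pos. }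
apply Rle_trans with (4 * B). cbv beta in A. nra.
unfold B, K. rewrite Rpower_plus, <- Rpower_mult_distr by lra.
assert (P1 := Rpower_ge_1 x beta Hx ltac:(lra)).
assert (P2 : Rpower 2 beta <= 2).
{ rewrite <- (Rpower_1 2) at 2 by lra. apply Rle_Rpower; lra. }
assert (P3 := Rpower_pos x e). assert (P4 := Rpower_pos 2 beta).
replace (16 / e * (2 * K0 + 1) * (Rpower x beta * Rpower x e)) with
  (4 * (((2 * K0 + 1) * Rpower x beta) * (4 / e * Rpower x e))) by (field; lra).
apply Rmult_le_compat_l. lra. apply Rmult_le_compat_r.
apply Rmult_le_pos. left; apply Rdiv_lt_0_compat; lra. lra.
assert (K0 * (Rpower 2 beta * Rpower x beta) <= K0 * (2 * Rpower x beta)).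
{ apply Rmult_le_compat_l. lra. apply Rmult_le_compat_r; lra. }
lra.
Qed.

(** * Beta coefficients and the sine product *)

Fixpoint sine_product (c : R) (N : nat) : R :=
  match N with O => 1 | S n => sine_product c n * (1 - c ^ 2 / INR (S n) ^ 2) end.

(** Used at p = 2 c, where N = 0 produces the sine, and at p = 0, where it is the Wallis integral
    serving as normalisation. *)
Definition cos_moment (p : R) (N : nat) : R := RInt (fun x => cos (p * x) * cos x ^ (2 * N)) 0 (PI / 2).

Lemma ex_RInt_cos_moment (p : R) (N : nat) (a b : R) :
  ex_RInt (fun x => cos (p * x) * cos x ^ (2 * N)) a b.
Proof.
apply (ex_RInt_continuous (V := R_CompleteNormedModule)). intros x _.
apply (ex_derive_continuous (V := R_NormedModule)). auto_derive. auto.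
Qed.

(* Green's identity for [cos (p x)] and [cos x ^ m] with [m = 2 N + 2]. *)
Lemma cos_moment_S (p : R) (N : nat) :
  (2 * INR N + 2) * (2 * INR N + 1) * cos_moment p N =
  ((2 * INR N + 2) ^ 2 - p ^ 2) * cos_moment p (S N).
Proof.
unfold cos_moment.
set (u := fun x => cos (p * x) * cos x ^ (2 * N)).
set (v := fun x => cos (p * x) * cos x ^ (2 * S N)).
set (m := 2 * INR N + 2).
assert (D : is_RInt (fun x => (m ^ 2 - p ^ 2) * v x - m * (2 * INR N + 1) * u x) 0 (PI / 2) 0).
(* V is the Wronskian of cos^m and cos (p x). Its positive powers of cos vanish at pi / 2 and its
   sines vanish at 0. *)
{ set (V := fun x => m * cos (p * x) * cos x ^ (2 * N + 1) * sin x - p * sin (p * x) * cos x ^ (2 * N + 2)).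
  assert (E : minus (V (PI / 2)) (V 0) = 0).
  { unfold V, minus, plus, opp; simpl. rewrite cos_PI2, !Rmult_0_r, !sin_0, !pow_i by lia. ring. }
  rewrite <- E at 2.
  apply (is_RInt_derive (V := R_CompleteNormedModule) V).
  - intros x _. unfold V, u, v. auto_derive. auto.
    replace (pred (N + (N + 0) + 1)) with (2 * N)%nat by lia.
    replace (pred (N + (N + 0) + 2)) with (2 * N + 1)%nat by lia.
    replace (N + (N + 0) + 1)%nat with (S (2 * N)) by lia.
    replace (N + (N + 0) + 2)%nat with (S (S (2 * N))) by lia.
    replace (2 * S N)%nat with (S (S (2 * N))) by lia.
    replace (2 * N + 1)%nat with (S (2 * N)) by lia.
    rewrite !S_INR, mult_INR. change (INR 2) with 2. simpl pow.
    assert (S := sin2_cos2 x). unfold Rsqr in S.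
    unfold m. set (q := cos x ^ (N + (N + 0))). 
    assert (S' : sin x ^ 2 = 1 - cos x ^ 2) by (simpl; lra).
    ring_simplify. rewrite S'. ring.
  - intros x _. apply (ex_derive_continuous (V := R_NormedModule)). unfold u, v. auto_derive. auto. }
apply (is_RInt_unique (V := R_CompleteNormedModule)) in D.
rewrite (RInt_minus (V := R_CompleteNormedModule) (fun x => (m ^ 2 - p ^ 2) * v x) (fun x => m * (2 * INR N + 1) * u x)) in D.
rewrite (RInt_scal (V := R_CompleteNormedModule) v), (RInt_scal (V := R_CompleteNormedModule) u) in D.
unfold minus, plus, opp, scal in D; simpl in D; unfold mult in D; simpl in D. simpl. lra.
apply ex_RInt_cos_moment. apply ex_RInt_cos_moment.
apply (ex_RInt_scal (V := R_NormedModule) v). apply ex_RInt_cos_moment.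
apply (ex_RInt_scal (V := R_NormedModule) u). apply ex_RInt_cos_moment.
Qed.

(** By the recurrence, the ratio of the moments at 2 c and at 0, times the product up to N, keeps
    its initial value sin (pi c) / (pi c). The ratio is at most 1 because cos (2 c x) <= 1, so the
    inequality holds at every finite N. *)
Lemma sine_product_ge (c : R) (N : nat) : 0 < c < 1 -> sin (PI * c) <= PI * c * sine_product c N.
Proof.
intros Hc. assert (HP := PI_RGT_0).
assert (J0 : cos_moment (2 * c) 0 = sin (PI * c) / (2 * c)).
{ unfold cos_moment. rewrite (RInt_ext _ (fun x => cos (2 * c * x))) by (intros; simpl; ring).
  apply is_RInt_unique.
  replace (sin (PI * c) / (2 * c)) with (minus (sin (2 * c * (PI / 2)) / (2 * c)) (sin (2 * c * 0) / (2 * c))).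
  2:{ rewrite Rmult_0_r, sin_0. unfold minus, plus, opp; simpl.
      replace (2 * c * (PI / 2)) with (PI * c) by field. field. lra. }
  apply (is_RInt_derive (V := R_CompleteNormedModule) (fun x => sin (2 * c * x) / (2 * c))).
  intros x _. auto_derive. auto. field. lra.
  intros x _. apply (ex_derive_continuous (V := R_NormedModule)). auto_derive. auto. }
assert (W0 : cos_moment 0 0 = PI / 2).
{ unfold cos_moment. rewrite (RInt_ext _ (fun x => 1)).
  rewrite RInt_const. unfold scal; simpl; unfold mult; simpl. ring.
  intros. simpl. rewrite Rmult_0_l, cos_0. ring. }
assert (K : 0 < cos_moment 0 N /\
  cos_moment (2 * c) N * sine_product c N * (PI / 2) = cos_moment 0 N * (sin (PI * c) / (2 * c))).
{ induction N as [|N [IH1 IH2]].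
  - rewrite J0, W0. simpl. split. lra. ring.
  - assert (HJ := cos_moment_S (2 * c) N). assert (HW := cos_moment_S 0 N).
    assert (HN := pos_INR N).
    assert (EW : cos_moment 0 (S N) = (2 * INR N + 1) / (2 * INR N + 2) * cos_moment 0 N).
    { apply Rmult_eq_reg_l with ((2 * INR N + 2) ^ 2 - 0 ^ 2). rewrite <- HW. field. lra.
      simpl. nra. }
    split. rewrite EW. apply Rmult_lt_0_compat. apply Rdiv_lt_0_compat; lra. exact IH1.
    rewrite EW. cbn [sine_product].
    assert (Hm : 0 < (2 * INR N + 2) ^ 2 - (2 * c) ^ 2) by (simpl; nra).
    assert (EJ : cos_moment (2 * c) (S N) = (2 * INR N + 2) * (2 * INR N + 1) / ((2 * INR N + 2) ^ 2 - (2 * c) ^ 2) * cos_moment (2 * c) N).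
    { apply Rmult_eq_reg_l with ((2 * INR N + 2) ^ 2 - (2 * c) ^ 2). rewrite <- HJ. field. lra. lra. }
    rewrite EJ, S_INR.
    replace ((2 * INR N + 1) / (2 * INR N + 2) * cos_moment 0 N * (sin (PI * c) / (2 * c)))
      with ((2 * INR N + 1) / (2 * INR N + 2) * (cos_moment (2 * c) N * sine_product c N * (PI / 2))) by (rewrite IH2; ring).
    simpl in Hm. field. repeat split; try lra; simpl; nra. }
destruct K as [K1 K2].
assert (L : cos_moment (2 * c) N <= cos_moment 0 N).
{ unfold cos_moment. apply RInt_le. lra. apply ex_RInt_cos_moment. apply ex_RInt_cos_moment.
  intros x _. apply Rmult_le_compat_r.
  rewrite pow_mult. apply pow_le. simpl. nra.
  rewrite Rmult_0_l, cos_0. apply COS_bound. }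
assert (HPr : 0 <= sine_product c N).
{ clear -Hc. induction N as [|N IH]. simpl; lra. cbn [sine_product].
  apply Rmult_le_pos. exact IH.
  assert (1 <= INR (S N)) by (rewrite S_INR; generalize (pos_INR N); lra).
  assert (c ^ 2 / INR (S N) ^ 2 <= 1); [|lra].
  apply Rmult_le_reg_r with (INR (S N) ^ 2). nra. unfold Rdiv. rewrite Rmult_assoc, Rinv_l; nra. }
assert (F : cos_moment 0 N * (sin (PI * c) / (2 * c)) <= cos_moment 0 N * (sine_product c N * (PI / 2))).
{ rewrite <- K2. rewrite Rmult_assoc. apply Rmult_le_compat_r. nra. exact L. }
apply Rmult_le_reg_l in F; [|exact K1].
apply Rmult_le_reg_r with (/ (2 * c)). apply Rinv_0_lt_compat; lra.
replace (PI * c * sine_product c N * / (2 * c)) with (sine_product c N * (PI / 2)) by (field; lra).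
exact F.
Qed.

(* [beta_coef c n] is the Beta value [B(n + 1, c)]. *)
Fixpoint beta_coef (c : R) (n : nat) : R :=
  match n with O => / c | S k => INR (S k) / (INR (S k) + c) * beta_coef c k end.

(** The Taylor coefficients alpha (alpha + 1) ... (alpha + n - 1) / n! of (1 - x)^(-alpha). *)
Fixpoint binom_coef (alpha : R) (n : nat) : R :=
  match n with O => 1 | S k => (alpha + INR k) / INR (S k) * binom_coef alpha k end.

Lemma beta_coef_pos (c : R) (n : nat) : 0 < c -> 0 < beta_coef c n.
Proof.
intros Hc. induction n as [|n IH]; cbn [beta_coef]. now apply Rinv_0_lt_compat.
apply Rmult_lt_0_compat; [|exact IH].
assert (0 < INR (S n)) by (apply lt_0_INR; lia). apply Rdiv_lt_0_compat; [exact H|].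
lra.
Qed.

Lemma binom_coef_pos (alpha : R) (n : nat) : 0 < alpha -> 0 < binom_coef alpha n.
Proof.
intros Ha. induction n as [|n IH]; cbn [binom_coef]. lra.
apply Rmult_lt_0_compat; [|exact IH]. apply Rdiv_lt_0_compat.
generalize (pos_INR n); lra. apply lt_0_INR; lia.
Qed.

(* Both sides satisfy the recursion with ratio [(n + 2 - c) / (n + 1)]. *)
Lemma beta_coef_binom_coef (c : R) (n : nat) : 0 < c < 1 ->
  INR (S n) * beta_coef c (S n) * (c * sine_product c (S n)) = (1 - c) * binom_coef (2 - c) n.
Proof.
intros Hc. induction n as [|n IH].
- simpl. field. lra.
- assert (H0 := pos_INR n).
  replace (INR (S (S n)) * beta_coef c (S (S n)) * (c * sine_product c (S (S n)))) with
    ((INR (S n) * beta_coef c (S n) * (c * sine_product c (S n))) *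
     (INR (S (S n)) / INR (S n) * (INR (S (S n)) / (INR (S (S n)) + c)) * (1 - c ^ 2 / INR (S (S n)) ^ 2))).
  + rewrite IH. cbn [binom_coef]. rewrite !S_INR. field. lra.
  + cbn [beta_coef sine_product]. rewrite !S_INR. field. lra.
Qed.

(** The preceding identity contains the factor c times the sine product, and the one-sided Euler
    product says that this factor times pi / sin (pi c) is at least 1. *)
Lemma beta_coef_le_binom_coef (c : R) (n : nat) : 0 < c < 1 ->
  INR (S n) * beta_coef c (S n) <= (1 - c) * (PI / sin (PI * c)) * binom_coef (2 - c) n.
Proof.
intros Hc. assert (HP := PI_RGT_0).
assert (Hs : 0 < sin (PI * c)) by (apply sin_gt_0; nra).
assert (H := sine_product_ge c (S n) Hc).
replace ((1 - c) * (PI / sin (PI * c)) * binom_coef (2 - c) n) with ((1 - c) * binom_coef (2 - c) n * (PI / sin (PI * c))) by ring.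
rewrite <- beta_coef_binom_coef by exact Hc.
rewrite Rmult_assoc. rewrite <- (Rmult_1_r (INR (S n) * beta_coef c (S n))) at 1.
apply Rmult_le_compat_l.
apply Rmult_le_pos. apply pos_INR. left; apply beta_coef_pos; lra.
apply Rmult_le_reg_r with (sin (PI * c)). exact Hs.
replace (c * sine_product c (S n) * (PI / sin (PI * c)) * sin (PI * c)) with (PI * c * sine_product c (S n)) by (field; lra).
lra.
Qed.

(** The truncated sum s satisfies (1 - y) s' = alpha s - (N + alpha) b_N y^N, with b_N the last
    coefficient. Hence (1 - y)^alpha s has derivative -(N + alpha) b_N y^N (1 - y)^(alpha - 1) <= 0,
    and it starts from 1 at y = 0. *)
Lemma binom_partial_sum_le (alpha x : R) (N : nat) : 0 < alpha -> 0 <= x < 1 ->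
  sum_n (fun n => binom_coef alpha n * x ^ n) N <= Rpower (1 - x) (- alpha).
Proof.
intros Ha Hx.
set (s := fun N x => sum_n (fun n => binom_coef alpha n * x ^ n) N).
assert (D : forall y, y < 1 -> is_derive (s N) y ((alpha * s N y - (INR N + alpha) * binom_coef alpha N * y ^ N) / (1 - y))).
{ intros y Hy. unfold s. induction N as [|N IH].
  - apply is_derive_ext with (fun _ => 1). intros t. rewrite R_sum_0. simpl. symmetry. apply Rmult_1_l.
    rewrite R_sum_0. simpl.
    replace ((alpha * (1 * 1) - (0 + alpha) * 1 * 1) / (1 - y)) with 0 by (field; lra).
    apply (is_derive_const (V := R_NormedModule)).
  - apply is_derive_ext with (fun t => sum_n (fun n => binom_coef alpha n * t ^ n) N + binom_coef alpha (S N) * t ^ S N).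
    intros t. now rewrite R_sum_S. rewrite R_sum_S.
    set (sy := sum_n (fun n => binom_coef alpha n * y ^ n) N) in *.
    replace ((alpha * (sy + binom_coef alpha (S N) * y ^ S N) - (INR (S N) + alpha) * binom_coef alpha (S N) * y ^ S N) / (1 - y))
      with ((alpha * sy - (INR N + alpha) * binom_coef alpha N * y ^ N) / (1 - y) + binom_coef alpha (S N) * (INR (S N) * y ^ N)).
    2:{ cbn [binom_coef pow]. rewrite S_INR. generalize (pos_INR N). intros. field. lra. }
    apply (is_derive_plus (V := R_NormedModule)). exact IH.
    apply (is_derive_scal (fun t => t ^ S N)). apply is_derive_Reals, (derivable_pt_lim_pow y (S N)). }
assert (Hinc := increment_le (fun y => Rpower (1 - y * 1) alpha * s N y) (fun _ => 1)
  (fun y => (- (alpha * 1) * Rpower (1 - y * 1) (alpha - 1)) * s N y +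
      Rpower (1 - y * 1) alpha * ((alpha * s N y - (INR N + alpha) * binom_coef alpha N * y ^ N) / (1 - y)))
  (fun _ => 0) 0 x ltac:(lra)).
assert (s0 : s N 0 = 1).
{ unfold s. clear. induction N as [|N IH]. rewrite R_sum_0. simpl. ring.
  rewrite R_sum_S, IH. simpl. ring. }
cbv beta in Hinc. rewrite s0, Rmult_0_l, Rminus_0_r, !Rmult_1_r in Hinc.
assert (R1 : Rpower 1 alpha = 1) by (unfold Rpower; rewrite ln_1, Rmult_0_r, exp_0; reflexivity).
rewrite R1 in Hinc.
assert (Rpower (1 - x) alpha * s N x - 1 <= 1 - 1).
{ apply Hinc.
  - intros y Hy.
    apply (is_derive_mult (K := R_AbsRing) (fun y => Rpower (1 - y * 1) alpha) (s N)).
    + assert (P := is_derive_Rpower_affine alpha 1 y ltac:(lra)). rewrite Rmult_1_r in P. exact P.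
    + apply D. lra.
    + intros; apply Rmult_comm.
  - intros y _. apply (is_derive_const (V := R_NormedModule)).
  - intros y Hy. rewrite !Rmult_1_r.
    assert (E : Rpower (1 - y) alpha = Rpower (1 - y) (alpha - 1) * (1 - y)).
    { rewrite <- (Rpower_1 (1 - y)) at 3 by lra. rewrite <- Rpower_plus. f_equal. ring. }
    rewrite E.
    replace (- alpha * Rpower (1 - y) (alpha - 1) * s N y +
      Rpower (1 - y) (alpha - 1) * (1 - y) * ((alpha * s N y - (INR N + alpha) * binom_coef alpha N * y ^ N) / (1 - y)))
      with (- (Rpower (1 - y) (alpha - 1) * ((INR N + alpha) * binom_coef alpha N * y ^ N))) by (field; lra).
    assert (0 <= Rpower (1 - y) (alpha - 1) * ((INR N + alpha) * binom_coef alpha N * y ^ N)); [|lra].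
    apply Rmult_le_pos. left; apply Rpower_pos.
    apply Rmult_le_pos. apply Rmult_le_pos. generalize (pos_INR N); lra. left; now apply binom_coef_pos.
    apply pow_le; lra. }
rewrite Rpower_Ropp. assert (P := Rpower_pos (1 - x) alpha).
apply Rmult_le_reg_l with (Rpower (1 - x) alpha). exact P. rewrite Rinv_r by lra. fold (s N x). lra.
Qed.

(** * The coefficients of the image *)

Lemma ex_series_bounded (u : nat -> R) (B : R) :
  (forall n, 0 <= u n) -> (forall n, sum_n u n <= B) -> ex_series u.
Proof.
intros Hu HB.
destruct (ex_finite_lim_seq_incr (sum_n u) B) as [l Hl].
- intros n. rewrite R_sum_S. specialize (Hu (S n)). lra.
- exact HB.
- exists l. exact Hl.
Qed.

Lemma ex_series_Rpower (d : R) : 0 < d -> ex_series (fun k => Rpower (INR (S k)) (- d - 1)).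
Proof.
intros Hd. apply ex_series_bounded with (1 + / d).
- intros n. left; apply Rpower_pos.
- intros n. apply Rle_trans with (1 + (1 - Rpower (INR (S n)) (- d)) / d).
  + induction n as [|n IH].
    * rewrite R_sum_0. simpl. unfold Rpower. rewrite ln_1, !Rmult_0_r, exp_0. lra.
    * rewrite R_sum_S. rewrite (S_INR (S n)).
      assert (Hn : 0 < INR (S n)) by (apply lt_0_INR; lia).
      destruct (Rpower_increment (- d) (INR (S n)) Hn) as [c [Hc1 Hc2]].
      assert (H := Rpower_le_neg (- d - 1) c (INR (S n) + 1) ltac:(lra) ltac:(lra)).
      apply Rle_trans with (1 + (1 - Rpower (INR (S n)) (- d)) / d + Rpower c (- d - 1)). lra.
      right. replace (Rpower (INR (S n) + 1) (- d)) with (Rpower (INR (S n)) (- d) + - d * Rpower c (- d - 1)) by lra.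
      field. lra.
  + assert (P := Rpower_pos (INR (S n)) (- d)). apply Rplus_le_compat_l.
    unfold Rdiv. rewrite <- (Rmult_1_l (/ d)) at 2. apply Rmult_le_compat_r.
    left; now apply Rinv_0_lt_compat. lra.
Qed.

Lemma Rpower_neg_small (d eps : R) : 0 < d -> 0 < eps ->
  exists N, forall n, (N <= n)%nat -> Rpower (INR (S n)) (- d) < eps.
Proof.
intros Hd He.
destruct (INR_unbounded (exp (- ln eps / d))) as [N HN].
exists N. intros n Hn.
assert (H1 : exp (- ln eps / d) < INR (S n)).
{ eapply Rlt_le_trans. exact HN. apply le_INR. lia. }
rewrite <- (exp_ln eps) by exact He. unfold Rpower. apply exp_increasing.
apply ln_increasing in H1; [|apply exp_pos]. rewrite ln_exp in H1.
apply Rmult_lt_compat_l with (r := d) in H1; [|exact Hd].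
replace (d * (- ln eps / d)) with (- ln eps) in H1 by (field; lra). lra.
Qed.

Lemma Rpower_sub_1 (x p : R) : 0 < x -> Rpower x (p - 1) = Rpower x p / x.
Proof.
intros Hx. unfold Rminus. rewrite Rpower_plus, Rpower_Ropp, Rpower_1 by exact Hx. reflexivity.
Qed.

(* Abel summation: the weights [1 / (n + k + 1)] have differences [O(k^-2)]. *)
Lemma hilbert_coef_converges (a : nat -> C) (g B : R) (n : nat) :
  0 < g < 1 -> (forall M, Cmod (C_sum a M) <= B * Rpower (INR (S M)) g) ->
  exists l : C, C_series (fun k => (a k / RtoC (INR (n + k + 1)))%C) l.
Proof.
intros Hg HB.
assert (HB0 : 0 <= B).
{ specialize (HB 0%nat). assert (P := Rpower_pos (INR 1) g). assert (Q := Cmod_ge_0 (C_sum a 0)). nra. }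
set (w := fun k => / INR (n + k + 1)).
assert (Hpos : forall k, INR (S k) <= INR (n + k + 1)) by (intros k; apply le_INR; lia).
assert (Hpos0 : forall k, 0 < INR (S k)) by (intros k; apply lt_0_INR; lia).
assert (HS : forall k, INR (n + S k + 1) = INR (n + k + 1) + 1).
{ intros k. rewrite <- S_INR. f_equal. lia. }
assert (Hw : forall k, 0 < w k <= / INR (S k)).
{ intros k. specialize (Hpos k). specialize (Hpos0 k). unfold w. split.
  apply Rinv_0_lt_compat. lra. apply Rinv_le_contravar; lra. }
assert (Hdw : forall k, 0 <= w k - w (S k) <= / INR (S k) * / INR (S k)).
{ intros k. specialize (Hpos k). specialize (Hpos0 k).
  assert (E : w k - w (S k) = / INR (n + k + 1) * / (INR (n + k + 1) + 1)).
  { unfold w. rewrite HS. field. lra. }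
  rewrite E. split. apply Rmult_le_pos; left; apply Rinv_0_lt_compat; lra.
  apply Rmult_le_compat; try (left; apply Rinv_0_lt_compat; lra); apply Rinv_le_contravar; lra. }
(* Here g < 1 is decisive: the summed terms are O(k^(g - 2)), hence summable, and the boundary term
   of the summation by parts is O(N^(g - 1)), hence tends to 0. *)
destruct (ex_C_series_le (fun k => (C_sum a k * RtoC (w k - w (S k)))%C)
  (fun k => B * Rpower (INR (S k)) (- (1 - g) - 1))) as [l Hl].
{ apply (ex_series_scal (V := R_NormedModule) B (fun k => Rpower (INR (S k)) (- (1 - g) - 1))).
  apply ex_series_Rpower. lra. }
{ intros k. rewrite Cmod_mult, Cmod_R, Rabs_pos_eq by apply Hdw.
  specialize (HB k). specialize (Hdw k). specialize (Hpos0 k).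
  replace (- (1 - g) - 1) with (g - 1 - 1) by ring. rewrite !Rpower_sub_1 by exact Hpos0.
  replace (B * (Rpower (INR (S k)) g / INR (S k) / INR (S k))) with
    (B * Rpower (INR (S k)) g * (/ INR (S k) * / INR (S k))) by (field; lra).
  apply Rmult_le_compat; try apply Cmod_ge_0; lra. }
exists l.
assert (Hsum : forall N, C_sum (fun k => (a k / RtoC (INR (n + k + 1)))%C) N =
  (C_sum a N * RtoC (w (S N)) + C_sum (fun k => (C_sum a k * RtoC (w k - w (S k)))%C) N)%C :> C).
{ assert (Hd : forall k, (a k / RtoC (INR (n + k + 1)))%C = (a k * RtoC (w k))%C).
  { intros k. unfold w, Cdiv. rewrite RtoC_inv. reflexivity. specialize (Hpos k). specialize (Hpos0 k). lra. }
  induction N as [|N IH].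
  - rewrite !C_sum_0, Hd, RtoC_minus. ring.
  - rewrite !C_sum_S, IH, Hd, RtoC_minus. ring. }
apply is_series_C_eps. intros eps He.
destruct (proj1 (is_series_C_eps _ _) Hl (eps / 2)) as [N1 HN1]. lra.
destruct (Rpower_neg_small (1 - g) (eps / 2 / (B + 1))) as [N2 HN2]. lra.
apply Rdiv_lt_0_compat; lra.
exists (max N1 N2). intros N HN. rewrite Hsum.
specialize (HN1 N ltac:(lia)). specialize (HN2 N ltac:(lia)).
set (X := C_sum (fun k => (C_sum a k * RtoC (w k - w (S k)))%C) N) in *.
replace (C_sum a N * w (S N) + X - l)%C with (C_sum a N * w (S N) + (X - l))%C by ring.
eapply Rle_lt_trans. apply Cmod_triangle.
assert (H : Cmod (C_sum a N * w (S N))%C <= B * Rpower (INR (S N)) (- (1 - g))).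
{ rewrite Cmod_mult, Cmod_R, Rabs_pos_eq by (left; apply Hw).
  replace (- (1 - g)) with (g - 1) by ring. rewrite Rpower_sub_1 by apply Hpos0.
  replace (B * (Rpower (INR (S N)) g / INR (S N))) with (B * Rpower (INR (S N)) g * / INR (S N)) by (unfold Rdiv; ring).
  apply Rmult_le_compat. apply Cmod_ge_0. left; apply Hw. apply HB.
  specialize (Hdw N). specialize (Hw N). lra. }
assert (B * Rpower (INR (S N)) (- (1 - g)) <= eps / 2).
{ apply Rle_trans with ((B + 1) * (eps / 2 / (B + 1))); [|right; field; lra].
  assert (P := Rpower_pos (INR (S N)) (- (1 - g))). nra. }
lra.
Qed.

(** The incomplete Beta integral of t^n (1 - t)^(c - 1) over (0, r), in the closed form given by
    integration by parts. Dropping the subtracted boundary term leaves the recursion of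
    [beta_coef]. *)
Fixpoint beta_primitive (c : R) (n : nat) (r : R) : R :=
  match n with
  | O => (1 - Rpower (1 - r) c) / c
  | S k => (INR (S k) * beta_primitive c k r - r ^ S k * Rpower (1 - r) c) / (INR (S k) + c)
  end.

Lemma is_derive_beta_primitive (c : R) (n : nat) (r : R) : 0 < c -> r < 1 ->
  is_derive (beta_primitive c n) r (r ^ n * Rpower (1 - r) (c - 1)).
Proof.
intros Hc Hr.
assert (HD : is_derive (fun r => Rpower (1 - r) c) r (- (c * Rpower (1 - r) (c - 1)))).
{ assert (P := is_derive_Rpower_affine c 1 r ltac:(lra)).
  rewrite !Rmult_1_r in P. replace (- (c * Rpower (1 - r) (c - 1))) with (- c * Rpower (1 - r) (c - 1)) by ring.
  eapply is_derive_ext; [|exact P]. intros t. cbv beta. now rewrite Rmult_1_r. }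
induction n as [|n IH]; cbn [beta_primitive].
- replace (r ^ 0 * Rpower (1 - r) (c - 1)) with ((0 - - (c * Rpower (1 - r) (c - 1))) * / c) by (simpl; field; lra).
  apply (is_derive_scal_l (K := R_AbsRing) (V := R_NormedModule) (fun r => 1 - Rpower (1 - r) c)).
  apply (is_derive_minus (V := R_NormedModule) (fun _ => 1)).
  apply (is_derive_const (V := R_NormedModule)). exact HD.
- assert (Hn : 0 < INR (S n)) by (apply lt_0_INR; lia).
  replace (r ^ S n * Rpower (1 - r) (c - 1)) with
    ((INR (S n) * (r ^ n * Rpower (1 - r) (c - 1)) -
      (INR (S n) * r ^ n * Rpower (1 - r) c + r ^ S n * (- (c * Rpower (1 - r) (c - 1))))) * / (INR (S n) + c)).
  2:{ rewrite (Rpower_sub_1 (1 - r) c) by lra. simpl pow. field. lra. }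
  apply (is_derive_scal_l (K := R_AbsRing) (V := R_NormedModule)
     (fun r => INR (S n) * beta_primitive c n r - r ^ S n * Rpower (1 - r) c)).
  apply (is_derive_minus (V := R_NormedModule)).
  apply is_derive_scal. exact IH.
  apply (is_derive_mult (K := R_AbsRing) (fun r => r ^ S n) (fun r => Rpower (1 - r) c)).
  apply is_derive_Reals, (derivable_pt_lim_pow r (S n)). exact HD. intros; apply Rmult_comm.
Qed.

Lemma beta_primitive_0 (c : R) (n : nat) : beta_primitive c n 0 = 0.
Proof.
assert (H1 : Rpower (1 - 0) c = 1) by (unfold Rpower; rewrite Rminus_0_r, ln_1, Rmult_0_r, exp_0; reflexivity).
induction n as [|n IH]; cbn [beta_primitive].
- rewrite H1. unfold Rdiv. ring.
- rewrite IH. simpl pow. unfold Rdiv. ring.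
Qed.

Lemma beta_primitive_le (c r : R) (n : nat) : 0 < c -> 0 <= r < 1 ->
  beta_primitive c n r <= beta_coef c n.
Proof.
intros Hc Hr. assert (P := Rpower_pos (1 - r) c).
induction n as [|n IH]; cbn [beta_primitive beta_coef].
- unfold Rdiv. rewrite <- (Rmult_1_l (/ c)) at 2. apply Rmult_le_compat_r. left; now apply Rinv_0_lt_compat. lra.
- assert (Hn : 0 < INR (S n)) by (apply lt_0_INR; lia).
  replace (INR (S n) / (INR (S n) + c) * beta_coef c n) with (INR (S n) * beta_coef c n / (INR (S n) + c)) by (field; lra).
  apply Rmult_le_compat_r. left; apply Rinv_0_lt_compat; lra.
  assert (0 <= r ^ S n) by (apply pow_le; lra). nra.
Qed.

(** [Abel] concerns the left limit at the radius of convergence itself. It covers radius 1; for a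
    larger radius the sum is continuous at 1. *)
Lemma abel_limit (A : nat -> R) : ex_series A ->
  Rbar_le 1 (CV_radius A) /\ filterlim (PSeries A) (at_left 1) (locally (Series A)).
Proof.
intros HA.
assert (HCV : Rbar_le 1 (CV_radius A)).
{ apply Rbar_not_lt_le. intros Hlt.
  apply (CV_disk_outside A 1). now rewrite Rabs_R1.
  apply is_lim_seq_ext with A. intros; rewrite pow1; ring. now apply ex_series_lim_0. }
split. exact HCV.
assert (E : Series A = PSeries A 1) by (symmetry; apply PSeries_1).
rewrite E.
destruct (Rbar_le_lt_or_eq_dec _ _ HCV) as [Hlt|Heq].
- apply (filterlim_filter_le_1 (F := locally 1) _ (filter_le_within (fun u => u < 1))).
  apply continuity_pt_filterlim. apply PSeries_continuity. now rewrite Rabs_R1.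
- assert (Ab := Abel A). rewrite <- Heq in Ab. apply Ab.
  simpl; lra. exact I. now apply ex_pseries_1.
Qed.

(** After rotation |b| is the sum of the real series A_k = Re (u a_k) / (n + k + 1). The function G
    r = r^(n+1) sum_k A_k r^k has derivative r^n Re (u f r), so it stands for the integral over (0,
    r). Its increments are compared with an explicit primitive, and Abel's theorem lets r tend to
    1. *)
Lemma hilbert_coef_bound (f : C -> C) (a : nat -> C) (b : C) (c F0 Q : R) (n : nat) :
  power_series_on_disk a f -> 0 < c -> 0 <= Q ->
  (forall z, Cmod z < 1 -> Cmod (f z) <= F0 + Q * (Rpower (1 - Cmod z) (c - 1) - 1)) ->
  C_series (fun k => (a k / RtoC (INR (n + k + 1)))%C) b ->
  Cmod b <= F0 / INR (S n) + Q * (beta_coef c n - / INR (S n)).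
Proof.
intros Ha Hc HQ Hf Hb.
destruct (unit_multiplier b) as [u [Hu1 Hu2]].
set (p := fun k => Re (u * a k)%C).
set (A := fun k => p k / INR (n + k + 1)).
assert (Hn : 0 < INR (S n)) by (apply lt_0_INR; lia).
assert (Hpos : forall k, 0 < INR (n + k + 1)) by (intros k; apply lt_0_INR; lia).
assert (HA : is_series A (Cmod b)).
{ assert (H := proj1 (C_series_re_im _ _) (C_series_scal u _ _ Hb)). destruct H as [H _].
  rewrite Hu2 in H. eapply is_series_ext; [|exact H]. intros k. cbv beta. unfold A, p.
  replace (u * (a k / INR (n + k + 1)))%C with (RtoC (/ INR (n + k + 1)) * (u * a k))%C.
  rewrite re_scal_l. unfold Rdiv. apply Rmult_comm.
  unfold Cdiv. rewrite RtoC_inv by (specialize (Hpos k); lra). ring. }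
destruct (abel_limit A (ex_intro _ _ HA)) as [HCV Hlim].
rewrite (is_series_unique _ _ HA) in Hlim.
(* The shift by n + 1 makes differentiation cancel exactly the denominators n + k + 1. *)
set (G := PSeries (PS_incr_n A (S n))).
assert (HCVG : Rbar_le 1 (CV_radius (PS_incr_n A (S n)))).
{ assert (E : forall m, CV_radius (PS_incr_n A m) = CV_radius A).
  { induction m as [|m IH]. reflexivity. simpl. now rewrite CV_radius_incr_1. }
  now rewrite E. }
assert (Hp : forall r, 0 <= r < 1 -> PSeries p r = Re (u * f (RtoC r))%C).
{ intros r Hr. apply is_pseries_unique. apply (proj2 (is_pseries_R _ _ _)).
  assert (Hz : unit_disk (RtoC r)) by (unfold unit_disk; rewrite Cmod_R, Rabs_pos_eq; lra).
  assert (H := proj1 (C_series_re_im _ _) (C_series_scal u _ _ (proj1 (C_pseries_series _ _ _) (Ha _ Hz)))).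
  destruct H as [H _]. eapply is_series_ext; [|exact H]. intros k. cbv beta. unfold p.
  rewrite <- RtoC_pow. replace (u * (RtoC (r ^ k) * a k))%C with (RtoC (r ^ k) * (u * a k))%C by ring.
  rewrite re_scal_l. apply Rmult_comm. }
assert (HG : forall r, 0 <= r < 1 -> is_derive G r (r ^ n * Re (u * f (RtoC r))%C)).
{ intros r Hr. rewrite <- Hp by exact Hr. rewrite <- PSeries_incr_n.
  replace (PSeries (PS_incr_n p n) r) with (PSeries (PS_derive (PS_incr_n A (S n))) r).
  - apply is_derive_PSeries. eapply Rbar_lt_le_trans; [|exact HCVG]. simpl. rewrite Rabs_pos_eq; lra.
  - apply PSeries_ext. intros k. unfold PS_derive. rewrite !PS_incr_n_simplify.
    destruct (Compare_dec.le_lt_dec (S n) (S k)) as [H1|H1]; destruct (Compare_dec.le_lt_dec n k) as [H2|H2]; try lia.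
    + replace (S k - S n)%nat with (k - n)%nat by lia. unfold A.
      replace (n + (k - n) + 1)%nat with (S k) by lia. assert (0 < INR (S k)) by (apply lt_0_INR; lia).
      field. lra.
    + apply Rmult_0_r. }
assert (HG0 : G 0 = 0).
{ unfold G. rewrite PSeries_incr_n. simpl. ring. }
(* The majorant F0 + Q ((1 - s)^(c-1) - 1) is regrouped as (F0 - Q) + Q (1 - s)^(c-1): a monomial
   part and a Beta part. The coefficient F0 - Q may be negative, so the monomial part is kept
   exact. *)
assert (Hmain : forall r, 0 <= r < 1 -> r ^ S n * (PSeries A r - (F0 - Q) / INR (S n)) <= Q * beta_coef c n).
{ intros r Hr.
  assert (H := increment_le G (fun s => (F0 - Q) / INR (S n) * s ^ S n + Q * beta_primitive c n s)
    (fun s => s ^ n * Re (u * f (RtoC s))%C)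
    (fun s => (F0 - Q) / INR (S n) * (INR (S n) * s ^ n) + Q * (s ^ n * Rpower (1 - s) (c - 1))) 0 r ltac:(lra)).
  cbv beta in H. rewrite HG0, beta_primitive_0, pow_i in H by lia.
  unfold G in H. rewrite PSeries_incr_n in H.
  assert (HB := beta_primitive_le c r n Hc Hr).
  assert (r ^ S n * PSeries A r - 0 <= (F0 - Q) / INR (S n) * r ^ S n + Q * beta_primitive c n r - ((F0 - Q) / INR (S n) * 0 + Q * 0)).
  { apply H.
    - intros s Hs. apply HG. lra.
    - intros s Hs. apply (is_derive_plus (V := R_NormedModule)).
      apply is_derive_scal. apply is_derive_Reals, (derivable_pt_lim_pow s (S n)).
      apply is_derive_scal. apply is_derive_beta_primitive; lra.
    - intros s Hs.
      replace ((F0 - Q) / INR (S n) * (INR (S n) * s ^ n) + Q * (s ^ n * Rpower (1 - s) (c - 1)))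
        with (s ^ n * (F0 + Q * (Rpower (1 - s) (c - 1) - 1))) by (field; lra).
      apply Rmult_le_compat_l. apply pow_le; lra.
      assert (Hs1 : Cmod (RtoC s) = s) by (rewrite Cmod_R, Rabs_pos_eq; lra).
      assert (Hfs := Hf (RtoC s) ltac:(lra)). rewrite Hs1 in Hfs.
      eapply Rle_trans. apply Rle_abs. eapply Rle_trans. apply re_le_Cmod. rewrite Cmod_mult.
      assert (Q0 := Cmod_ge_0 (f (RtoC s))). nra. }
  assert (Q * beta_primitive c n r <= Q * beta_coef c n) by now apply Rmult_le_compat_l.
  lra. }
assert (Hfin : Rbar_le (1 ^ S n * (Cmod b - (F0 - Q) / INR (S n))) (Q * beta_coef c n)).
{ apply (filterlim_le (F := at_left 1) (fun r => r ^ S n * (PSeries A r - (F0 - Q) / INR (S n))) (fun _ => Q * beta_coef c n)).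
  - exists (mkposreal 1 Rlt_0_1). intros y Hy Hy1. apply Hmain.
    change (Rabs (y - 1) < 1) in Hy. apply Rabs_def2 in Hy. lra.
  - apply (filterlim_comp_2 (G := locally (1 ^ S n)) (H := locally (Cmod b - (F0 - Q) / INR (S n)))
      (fun r => r ^ S n) (fun r => PSeries A r - (F0 - Q) / INR (S n)) Rmult).
    + apply (filterlim_filter_le_1 (F := locally 1) _ (filter_le_within (fun u => u < 1))).
      apply (ex_derive_continuous (V := R_NormedModule) (fun r => r ^ S n)). auto_derive. auto.
    + apply (filterlim_comp_2 (G := locally (Cmod b)) (H := locally (- ((F0 - Q) / INR (S n))))
       (PSeries A) (fun _ => - ((F0 - Q) / INR (S n))) Rplus).
      exact Hlim. apply filterlim_const.
      apply (filterlim_plus (V := R_NormedModule)).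
    + apply (filterlim_mult (K := R_AbsRing)).
  - apply filterlim_const. }
cbn [Rbar_le] in Hfin. rewrite pow1, Rmult_1_l in Hfin.
replace (F0 / INR (S n) + Q * (beta_coef c n - / INR (S n))) with (Q * beta_coef c n + (F0 - Q) / INR (S n)) by (field; lra).
lra.
Qed.

(** * Norm of the image, its existence and the conclusion *)

Lemma Rpower_le_1 (y p : R) : 0 < y <= 1 -> 0 <= p -> Rpower y p <= 1.
Proof.
intros Hy Hp. apply Rle_trans with (Rpower 1 p). now apply Rle_Rpower_l.
unfold Rpower. rewrite ln_1, Rmult_0_r, exp_0. lra.
Qed.

Lemma Rpower_one_minus_sq (alpha x : R) : 0 <= x < 1 ->
  Rpower (1 - x ^ 2) alpha = Rpower (1 + x) alpha * Rpower (1 - x) alpha.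
Proof.
intros Hx. rewrite Rpower_mult_distr by lra. f_equal. ring.
Qed.

(** Extracts a real seminorm M from the extended supremum. The pointwise bound drops the factor (1 +
    |z|)^alpha >= 1, so that it depends on 1 - |z| alone and can be compared with explicit
    primitives. *)
Lemma bloch_norm_finite (alpha : R) (f : C -> C) :
  0 <= alpha -> Rbar_lt (bloch_norm alpha f) p_infty ->
  exists M, 0 <= M /\ bloch_norm alpha f = Finite (Cmod (f (RtoC 0)) + M) /\
    forall z, Cmod z < 1 -> Cmod (C_derive f z) <= M * Rpower (1 - Cmod z) (- alpha).
Proof.
unfold bloch_norm, bloch_seminorm. intros Ha H.
match type of H with context [Lub_Rbar ?E] => set (S := E) in *; assert (HS := Lub_Rbar_correct S) end.
destruct HS as [Hub _].
(* The point z = 0 puts a nonnegative number below the supremum, which excludes minus infinity and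
   gives 0 <= M. *)
assert (H0 : Rbar_le (Cmod (C_derive f (RtoC 0))) (Lub_Rbar S)).
{ apply Hub. exists (RtoC 0). unfold unit_disk. rewrite Cmod_0. split. lra.
  replace (1 - 0 ^ 2) with 1 by ring. unfold Rpower. rewrite ln_1, Rmult_0_r, exp_0. ring. }
destruct (Lub_Rbar S) as [M| |] eqn:E; simpl in H, H0; try contradiction.
exists M. split. eapply Rle_trans; [apply Cmod_ge_0|exact H0]. split. reflexivity.
intros z Hz. assert (Hz0 := Cmod_ge_0 z).
assert (Hb : Rbar_le (Rpower (1 - Cmod z ^ 2) alpha * Cmod (C_derive f z)) M).
{ apply Hub. now exists z. }
cbn [Rbar_le] in Hb. rewrite Rpower_one_minus_sq in Hb by lra.
assert (P1 := Rpower_pos (1 - Cmod z) alpha).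
assert (P2 := Rpower_ge_1 (1 + Cmod z) alpha ltac:(lra) Ha).
rewrite Rpower_Ropp.
apply Rmult_le_reg_r with (Rpower (1 - Cmod z) alpha). exact P1.
rewrite Rmult_assoc, Rinv_l by lra.
assert (P3 := Cmod_ge_0 (C_derive f z)).
assert (0 <= Cmod (C_derive f z) * Rpower (1 - Cmod z) alpha) by nra. nra.
Qed.

Lemma hilbert_coef_le (alpha M : R) (f : C -> C) (a b : nat -> C) :
  1 < alpha < 2 -> 0 <= M -> analytic_on_disk f ->
  (forall z, Cmod z < 1 -> Cmod (C_derive f z) <= M * Rpower (1 - Cmod z) (- alpha)) ->
  power_series_on_disk a f ->
  (forall n, C_series (fun k => (a k / RtoC (INR (n + k + 1)))%C) (b n)) ->
  forall n, Cmod (b n) <= Cmod (f (RtoC 0)) / INR (S n) +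
    M / (alpha - 1) * (beta_coef (2 - alpha) n - / INR (S n)).
Proof.
intros Ha HM Hf HfM Hpa Hb n.
apply (hilbert_coef_bound f a (b n)); auto.
- lra.
- apply Rmult_le_pos. exact HM. left; apply Rinv_0_lt_compat; lra.
- intros z Hz.
  replace (2 - alpha - 1) with (1 - alpha) by ring.
  apply bloch_growth; auto. lra. intros w Hw. now apply analytic_on_disk_C_derive.
Qed.

(** The coefficient 3 of |f 0| is 1 from |g 0| plus 2 from the seminorm, where |f 0| contributes |f
    0| / (1 - x) to |g'| and (1 - x^2)^alpha / (1 - x) <= 1 + x <= 2. The two terms multiplying M
    come from the derivative and from g 0 respectively. *)
Lemma hilbert_bloch_norm_le (alpha M : R) (f g : C -> C) (a b : nat -> C) :
  1 < alpha < 2 -> 0 <= M -> analytic_on_disk f ->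
  (forall z, Cmod z < 1 -> Cmod (C_derive f z) <= M * Rpower (1 - Cmod z) (- alpha)) ->
  power_series_on_disk a f ->
  (forall n, C_series (fun k => (a k / RtoC (INR (n + k + 1)))%C) (b n)) ->
  power_series_on_disk b g ->
  Rbar_le (bloch_norm alpha g)
    (Finite (3 * Cmod (f (RtoC 0)) +
       M * (Rpower 2 alpha * PI / sin ((alpha - 1) * PI) + 1 / (2 - alpha)))).
Proof.
intros Ha HM Hf HfM Hpa Hb Hpb.
set (F0 := Cmod (f (RtoC 0))). set (c := 2 - alpha).
assert (HF0 : 0 <= F0) by apply Cmod_ge_0.
assert (Hc : 0 < c < 1) by (unfold c; lra).
set (Q := M / (1 - c)).
assert (HQ : 0 <= Q). { unfold Q. apply Rmult_le_pos. exact HM. left; apply Rinv_0_lt_compat; lra. }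
assert (Hbn := hilbert_coef_le alpha M f a b Ha HM Hf HfM Hpa Hb).
replace (alpha - 1) with (1 - c) in Hbn by (unfold c; ring). fold F0 Q c in Hbn.
set (s := sin (PI * c)).
(* Reflection: pi - pi c = (alpha - 1) pi. *)
assert (Es : sin ((alpha - 1) * PI) = s).
{ unfold s. rewrite <- (sin_PI_x (PI * c)). f_equal. unfold c. ring. }
rewrite Es.
assert (HP := PI_RGT_0).
assert (Hs : 0 < s) by (unfold s; apply sin_gt_0; nra).
(* The negative contribution of - 1 / (n + 2) is discarded, and the factor 1 - c of the Beta
   estimate cancels the denominator of Q. *)
assert (Hcoef : forall n, Cmod (C_PS_derive b n) <= F0 + M * (PI / s) * binom_coef alpha n).
{ intros n. unfold C_PS_derive. rewrite Cmod_mult, Cmod_R, Rabs_pos_eq by apply pos_INR.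
  assert (Hn : 1 <= INR (S n)) by (rewrite S_INR; generalize (pos_INR n); lra).
  assert (Hn2 : INR (S (S n)) = INR (S n) + 1) by apply S_INR.
  assert (B := beta_coef_le_binom_coef c n Hc). fold s in B.
  replace (2 - c) with alpha in B by (unfold c; ring).
  eapply Rle_trans. apply Rmult_le_compat_l. lra. apply (Hbn (S n)).
  assert (Hi := Rinv_0_lt_compat (INR (S (S n))) ltac:(lra)).
  replace (INR (S n) * (F0 / INR (S (S n)) + Q * (beta_coef c (S n) - / INR (S (S n)))))
    with (F0 * (INR (S n) / INR (S (S n))) + Q * (INR (S n) * beta_coef c (S n)) - Q * INR (S n) * / INR (S (S n))) by (field; lra).
  assert (T1 : INR (S n) / INR (S (S n)) <= 1).
  { apply Rmult_le_reg_r with (INR (S (S n))). lra. unfold Rdiv. rewrite Rmult_assoc, Rinv_l; lra. }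
  assert (T2 : F0 * (INR (S n) / INR (S (S n))) <= F0 * 1) by (apply Rmult_le_compat_l; lra).
  assert (T3 : Q * (INR (S n) * beta_coef c (S n)) <= Q * ((1 - c) * (PI / s) * binom_coef alpha n)) by (apply Rmult_le_compat_l; lra).
  replace (Q * ((1 - c) * (PI / s) * binom_coef alpha n)) with (M * (PI / s) * binom_coef alpha n) in T3
    by (unfold Q; field; lra).
  assert (T4 : 0 <= Q * INR (S n) * / INR (S (S n))).
  { apply Rmult_le_pos. apply Rmult_le_pos; lra. lra. }
  lra. }
assert (Hsemi : Rbar_le (bloch_seminorm alpha g) (Finite (2 * F0 + M * (Rpower 2 alpha * PI / s)))).
{ apply (proj2 (Lub_Rbar_correct _)). intros y [z [Hz ->]]. unfold unit_disk in Hz.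
  assert (Hz0 := Cmod_ge_0 z). set (x := Cmod z) in *.
  destruct (C_pseries_C_derive b 1 g Hpb z Hz) as [_ Hd].
  apply (proj1 (C_pseries_series _ _ _)) in Hd.
  assert (D : Cmod (C_derive g z) <= F0 * / (1 - x) + M * (PI / s) * Rpower (1 - x) (- alpha)).
  { apply (Cmod_series_le_bound _ _ _ Hd). intros N.
    eapply Rle_trans. apply Cmod_C_sum_le with (b := fun n => F0 * x ^ n + M * (PI / s) * (binom_coef alpha n * x ^ n)).
    - intros k _. rewrite Cmod_mult, Cmod_pow. fold x.
      eapply Rle_trans. apply Rmult_le_compat_l. now apply pow_le. apply Hcoef. right; ring.
    - rewrite R_sum_plus, !R_sum_scal. apply Rplus_le_compat.
      + apply Rmult_le_compat_l. exact HF0.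
        apply sum_n_le_series. intros k. now apply pow_le.
        apply is_series_geom. rewrite Rabs_pos_eq; lra.
      + apply Rmult_le_compat_l. apply Rmult_le_pos. exact HM. left; now apply Rdiv_lt_0_compat.
        apply binom_partial_sum_le; lra. }
  cbn [Rbar_le].
  assert (P := Rpower_pos (1 - x ^ 2) alpha).
  eapply Rle_trans. apply Rmult_le_compat_l. left; exact P. exact D.
  rewrite Rmult_plus_distr_l. apply Rplus_le_compat.
  - replace (Rpower (1 - x ^ 2) alpha) with (Rpower (1 - x ^ 2) (alpha - 1) * (1 - x ^ 2)).
    2:{ rewrite Rpower_sub_1 by nra. field. nra. }
    replace (Rpower (1 - x ^ 2) (alpha - 1) * (1 - x ^ 2) * (F0 * / (1 - x)))
      with (Rpower (1 - x ^ 2) (alpha - 1) * ((1 + x) * F0)) by (field; lra).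
    assert (P1 := Rpower_le_1 (1 - x ^ 2) (alpha - 1) ltac:(nra) ltac:(lra)).
    assert (P2 := Rpower_pos (1 - x ^ 2) (alpha - 1)).
    apply Rle_trans with (1 * ((1 + x) * F0)). apply Rmult_le_compat_r; nra. nra.
  - rewrite Rpower_one_minus_sq by lra. rewrite Rpower_Ropp.
    assert (P1 := Rpower_pos (1 - x) alpha).
    replace (Rpower (1 + x) alpha * Rpower (1 - x) alpha * (M * (PI / s) * / Rpower (1 - x) alpha))
      with (Rpower (1 + x) alpha * (M * (PI / s))) by (field; lra).
    replace (M * (Rpower 2 alpha * PI / s)) with (Rpower 2 alpha * (M * (PI / s))) by (field; lra).
    apply Rmult_le_compat_r. apply Rmult_le_pos. exact HM. left; now apply Rdiv_lt_0_compat.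
    apply Rle_Rpower_l; lra. }
assert (Hg0 : Cmod (g (RtoC 0)) <= F0 + M * (1 / c)).
{ assert (E : g (RtoC 0) = b 0%nat).
  { assert (H0 : unit_disk (RtoC 0)) by (unfold unit_disk; rewrite Cmod_0; lra).
    apply (C_series_unique _ _ _ (Hpb _ H0)).
    exact (is_pseries_0 (K := C_AbsRing) (V := C_NormedModule) b). }
  (* At n = 0 the subtracted 1 / (n + 1) matters: Q (1 / c - 1) = M / c exactly, so the singular
     denominator 1 - c of Q disappears. *)
  rewrite E. specialize (Hbn 0%nat). simpl in Hbn.
  replace (F0 / 1 + Q * (/ c - / 1)) with (F0 + M * (1 / c)) in Hbn by (unfold Q; field; lra).
  exact Hbn. }
unfold bloch_norm.
destruct (bloch_seminorm alpha g) as [S| |]; simpl in Hsemi; try contradiction; simpl; [|exact I].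
fold F0. lra.
Qed.

Lemma beta_coef_le (c : R) (n : nat) : 0 < c -> beta_coef c n <= / c.
Proof.
intros Hc. induction n as [|n IH]; cbn [beta_coef]. lra.
assert (Hn : 0 < INR (S n)) by (apply lt_0_INR; lia).
assert (P := beta_coef_pos c n Hc).
apply Rle_trans with (1 * beta_coef c n); [|lra].
apply Rmult_le_compat_r. lra.
apply Rmult_le_reg_r with (INR (S n) + c). lra. unfold Rdiv. rewrite Rmult_assoc, Rinv_l; lra.
Qed.

(** The coefficients b_n exist by the growth of the partial sums and are bounded by the integral
    estimate, so their power series converges on the disk and defines the image. *)
Lemma hilbert_exists (alpha M : R) (f : C -> C) :
  1 < alpha < 2 -> 0 <= M -> analytic_on_disk f ->
  (forall z, Cmod z < 1 -> Cmod (C_derive f z) <= M * Rpower (1 - Cmod z) (- alpha)) ->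
  exists g, is_hilbert f g.
Proof.
intros Ha HM Hf HfM.
destruct (analytic_on_disk_pseries f Hf) as [a Hpa].
assert (Hgrow : forall z, Cmod z < 1 ->
  Cmod (f z) <= (Cmod (f (RtoC 0)) + M / (alpha - 1)) * Rpower (1 - Cmod z) (- (alpha - 1))).
{ intros z Hz.
  assert (G := bloch_growth f alpha M ltac:(lra) (fun w Hw => proj1 (analytic_on_disk_C_derive f Hf w Hw)) HfM z Hz).
  replace (- (alpha - 1)) with (1 - alpha) by ring.
  assert (Hz0 := Cmod_ge_0 z). assert (HF0 := Cmod_ge_0 (f (RtoC 0))).
  assert (P : 1 <= Rpower (1 - Cmod z) (1 - alpha)).
  { replace 1 with (Rpower 1 (1 - alpha)) at 1 by (unfold Rpower; rewrite ln_1, Rmult_0_r; apply exp_0).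
    apply Rpower_le_neg; lra. }
  assert (0 <= M / (alpha - 1)). { apply Rmult_le_pos. exact HM. left; apply Rinv_0_lt_compat; lra. }
  nra. }
assert (HK : 0 <= Cmod (f (RtoC 0)) + M / (alpha - 1)).
{ apply Rplus_le_le_0_compat. apply Cmod_ge_0. apply Rmult_le_pos. exact HM. left; apply Rinv_0_lt_compat; lra. }
(* With e = (2 - alpha) / 2 the growth exponent alpha - 1 + e is alpha / 2, still below 1. *)
destruct (partial_sums_growth a f _ (alpha - 1) ((2 - alpha) / 2) Hpa ltac:(lra) ltac:(lra) HK Hgrow) as [B HB].
(* [Series] is total, so the sums are explicit functions of the index, and of the point for [g]
   below; convergence is established afterwards, by components. *)
set (b := fun n => (Series (fun k => Re (a k / RtoC (INR (n + k + 1)))%C),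
                    Series (fun k => Im (a k / RtoC (INR (n + k + 1)))%C)) : C).
assert (Hb : forall n, C_series (fun k => (a k / RtoC (INR (n + k + 1)))%C) (b n)).
{ intros n. destruct (hilbert_coef_converges a (alpha - 1 + (2 - alpha) / 2) B n ltac:(lra) HB) as [l Hl].
  apply C_series_re_im in Hl. destruct Hl as [H1 H2]. apply C_series_re_im. split.
  - apply Series_correct. now exists (Re l).
  - apply Series_correct. now exists (Im l). }
assert (Hbn := hilbert_coef_le alpha M f a b Ha HM Hf HfM Hpa Hb).
set (K := Cmod (f (RtoC 0)) + M / (alpha - 1) * / (2 - alpha)).
assert (Hbd : forall n, Cmod (b n) <= K).
{ intros n. eapply Rle_trans. apply Hbn. unfold K.
  assert (Hn : 1 <= INR (S n)) by (rewrite S_INR; generalize (pos_INR n); lra).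
  assert (Hi : 0 < / INR (S n) <= 1).
  { split. apply Rinv_0_lt_compat; lra. rewrite <- Rinv_1. apply Rinv_le_contravar; lra. }
  assert (Q0 : 0 <= M / (alpha - 1)). { apply Rmult_le_pos. exact HM. left; apply Rinv_0_lt_compat; lra. }
  assert (Hbeta := beta_coef_le (2 - alpha) n ltac:(lra)).
  assert (HF0 := Cmod_ge_0 (f (RtoC 0))).
  apply Rplus_le_compat. unfold Rdiv. nra. apply Rmult_le_compat_l; lra. }
set (t := fun z k => (z ^ k * b k)%C).
set (g := fun z => (Series (fun k => Re (t z k)), Series (fun k => Im (t z k))) : C).
assert (Hg : power_series_on_disk b g).
{ intros z Hz. apply (proj2 (C_pseries_series _ _ _)).
  destruct (ex_C_series_le (t z) (fun k => K * Cmod z ^ k)) as [l Hl].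
  - apply (ex_series_scal (V := R_NormedModule) K (fun k => Cmod z ^ k)).
    apply ex_series_geom. rewrite Rabs_pos_eq by apply Cmod_ge_0. exact Hz.
  - intros k. unfold t. rewrite Cmod_mult, Cmod_pow, Rmult_comm.
    apply Rmult_le_compat_r. apply pow_le, Cmod_ge_0. apply Hbd.
  - apply C_series_re_im in Hl. destruct Hl as [H1 H2]. apply C_series_re_im. split.
    + apply Series_correct. now exists (Re l).
    + apply Series_correct. now exists (Im l). }
exists g, a, b. repeat split; auto. now apply pseries_analytic_on_disk with b.
Qed.

(** The supremum in [operator_norm] ranges only over those f that have an image. The first conjunct
    records that every Bloch function has one and that it lies in the same space, so the bound
    concerns an everywhere defined operator. *)
Theorem theorem5p2 (alpha : R) (halpha1 : 1 < alpha) (halpha2 : alpha < 2) :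
  (forall f : C -> C, bloch_space alpha f ->
    exists g : C -> C, is_hilbert f g /\ bloch_space alpha g) /\
  Rbar_le
    (operator_norm is_hilbert (bloch_space alpha) (bloch_norm alpha) (bloch_norm alpha))
    (Finite (Rpower 2 alpha * PI / sin ((alpha - 1) * PI) + 1 / (2 - alpha))).
Proof.
split.
- intros f [Hf Hn].
  destruct (bloch_norm_finite alpha f ltac:(lra) Hn) as [M [HM [_ HfM]]].
  destruct (hilbert_exists alpha M f (conj halpha1 halpha2) HM Hf HfM) as [g Hg].
  exists g. split. exact Hg.
  destruct Hg as [a [b [Hpa [Hb [Hpb Hag]]]]].
  split. exact Hag.
  eapply Rbar_le_lt_trans.
  apply (hilbert_bloch_norm_le alpha M f g a b); auto. exact I.
- unfold operator_norm, Rbar_lub.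
  match goal with |- context [Rbar_ex_lub ?E] => destruct (Rbar_ex_lub E) as [l [Hub Hl]] end; simpl proj1_sig.
  apply Hl. intros y [f [g [[Hf Hn] [H1 [[a [b [Hpa [Hb [Hpb Hag]]]]] ->]]]]].
  destruct (bloch_norm_finite alpha f ltac:(lra) Hn) as [M [HM [E HfM]]].
  rewrite E in H1. cbn [Rbar_le] in H1.
  eapply Rbar_le_trans.
  apply (hilbert_bloch_norm_le alpha M f g a b); auto.
  cbn [Rbar_le].
  set (T := Rpower 2 alpha * PI / sin ((alpha - 1) * PI) + 1 / (2 - alpha)).
  assert (HP := PI2_3_2).
  assert (Hs : 0 < sin ((alpha - 1) * PI)) by (apply sin_gt_0; nra).
  assert (Hs1 := SIN_bound ((alpha - 1) * PI)).
  assert (H2 : 1 <= Rpower 2 alpha) by (apply Rpower_ge_1; lra).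
  (* From 2^alpha >= 1, pi >= 3 and sin <= 1. With this, 3 |f 0| + M T <= T (|f 0| + M) <= T. *)
  assert (HT : 3 <= T).
  { assert (0 < 1 / (2 - alpha)) by (apply Rdiv_lt_0_compat; lra).
    assert (3 <= Rpower 2 alpha * PI / sin ((alpha - 1) * PI)); [|unfold T; lra].
    apply Rmult_le_reg_r with (sin ((alpha - 1) * PI)). exact Hs.
    unfold Rdiv. rewrite Rmult_assoc, Rinv_l by lra. nra. }
  assert (HF0 := Cmod_ge_0 (f (RtoC 0))). nra.
Qed.
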